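(* Let $(A_0,A_1)$ be a mutually closed and regular Banach couple, $0<q\le1$, and let $B\in SV(0,\infty)$ satisfy $$\sup_{m\in\mathbb Z}\frac{\min\{1,2^m\}}{B(2^m)}<\infty .$$ Assume, moreover, that $$B^q(t)=\int_0^t b^q(s)\,\frac{ds}{s},\qquad t>0,$$ for some $b\in SV(0,\infty)$. Then $$\big((A_0,A_1)^J_{1,q,B}\big)'=(A_0',A_1')^J_{1,\infty,1/\overline a},$$ where $a(t)=tB'(t)=\tfrac1q B(t)^{1-q}b(t)^q$, the derivative being understood in the a.e. sense, and $\overline a(t)=a(\tfrac1t)$ for $t>0$.
   Context: A Banach couple $(A_0,A_1)$ is a compatible couple of Banach spaces (both continuously embedded in a common Hausdorff topological vector space) with $A_0\cap A_1\neq\{0\}$. It is regular if $A_0\cap A_1$ is dense in $A_0$ and in $A_1$. The Gagliardo completion $A_k^{\sim}$ ($k=0,1$) is the set of all $a\in A_0+A_1$ that are limits in $A_0+A_1$ of some sequence bounded in $A_k$, with norm $\|a\|_{A_k^{\sim}}=\inf\{\sup_n\|a_n\|_{A_k}:\|a_n-a\|_{A_0+A_1}\to0\}$. The couple is mutually closed if $(A_0,A_1)=(A_0^{\sim},A_1^{\sim})$. $SV(0,\infty)$: a positive Lebesgue measurable function $b$ on $(0,\infty)$ ($0\not\equiv b\not\equiv\infty$) is slowly varying if for each $\varepsilon>0$ the function $t\mapsto t^{\varepsilon}b(t)$ is equivalent to an increasing function and $t\mapsto t^{-\varepsilon}b(t)$ is equivalent to a decreasing function (equivalent: each is bounded by a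 positive constant times the other). Slowly varying parameters are considered up to equivalence. $J$-space: for a Banach couple $(X_0,X_1)$, $J(t,f)=\max\{\|f\|_{X_0},t\|f\|_{X_1}\}$ for $f\in X_0\cap X_1$; for $0<r\le\infty$ and $w\in SV(0,\infty)$, $(X_0,X_1)^J_{1,r,w}$ consists of all $f\in X_0+X_1$ having a representation $f=\sum_{k\in\mathbb Z}u_k$ (convergence in $X_0+X_1$), $u_k\in X_0\cap X_1$, with $\|(2^{-k}w(2^k)J(2^k,u_k))_k\|_{\ell_r(\mathbb Z)}<\infty$; its quasi-norm is the infimum of these quantities over all such representations. Duals: for a regular couple, each element of $A_i^*$ is identified with its restriction to $A_0\cap A_1$; $A_i'$ ($i=0,1$) is the Banach space of functionals on $A_0\cap A_1$ that extend continuously to $A_i$ (with the norm of $A_i^*$). Thus $(A_0',A_1')$ is a Banach couple inside $(A_0\cap A_1)^*$. Likewise, $E'$ denotes the dual (space of continuous linear functionals) of an intermediate quasi-Banach space $E$, its elements being identified with their restrictions to $A_0\cap A_1$. Equalities of spaces are with equivalence of norms. *)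

(* Defs.v *)
From HB Require Import structures.
From mathcomp Require Import all_boot all_order all_algebra.
From mathcomp Require Import complex.
From mathcomp Require Import all_classical all_reals all_analysis.

Set Implicit Arguments.
Unset Strict Implicit.
Unset Printing Implicit Defensive.

Import Order.TTheory GRing.Theory Num.Theory.
Import numFieldTopology.Exports numFieldNormedType.Exports.

Local Open Scope classical_set_scope.
Local Open Scope ring_scope.

(* Banach spaces are real or complex. Library norms of normed modules over K
   take their values in K; [real_part] brings them back to R. *)
Variant scalars := RealScalars | ComplexScalars.

Definition scalar_field (R : realType) (F : scalars) : numFieldType :=
  match F with RealScalars => R | ComplexScalars => R[i] end.

Definition real_part (R : realType) (F : scalars) : scalar_field R F -> R :=
  match F return scalar_field R F -> R with
  | RealScalars => fun x => x
  | ComplexScalars => fun z => complex.Re z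
  end.

Definition modulus (R : realType) (F : scalars) (z : scalar_field R F) : R :=
  real_part `|z|.

(* [side k] with k = false is A_0, with k = true it is A_1. *)
Record banach_couple (K : numFieldType) := BanachCouple {
  ambient : topologicalLmodType K ;
  ambient_hausdorff : hausdorff_space ambient ;
  side : bool -> completeNormedModType K ;
  emb : forall k, {linear side k -> ambient} ;
  emb_inj : forall k, injective (emb k) ;
  emb_continuous : forall k, continuous (emb k) ;
  couple_nontrivial :
    exists2 x : ambient, x != 0 & forall k, range (emb k) x
}.

(* Inside a fixed vector space W, a (quasi-)normed subspace E is given by its
   extended norm N : W -> \bar R, equal to +oo exactly off E; a couple is a
   family N indexed by bool. *)
Section extended_norms.
Context {R : realType} {W : zmodType}.
Implicit Types (N : bool -> W -> \bar R) (f x : W).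
Local Open Scope ereal_scope.

Definition norm_equiv (N1 N2 : W -> \bar R) : Prop :=
  exists2 C : R, (0 < C)%R &
    forall x, N1 x <= C%:E * N2 x /\ N2 x <= C%:E * N1 x.

Definition cap_space N : set W := [set x | forall k, N k x < +oo].

Definition sum_norm N x : \bar R :=
  ereal_inf [set N false y.1 + N true y.2 |
             y in [set y : W * W | x = (y.1 + y.2)%R]].

(* Unbounded sequences contribute +oo to the infimum. *)
Definition gagliardo_norm N (k : bool) (x : W) : \bar R :=
  ereal_inf [set ereal_sup (range (N k \o s)) |
    s in [set s : nat -> W | (forall n, N k (s n) < +oo) /\
                             sum_norm N (s n - x)%R @[n --> \oo] --> 0]].

Definition mutually_closed N : Prop :=
  forall k, norm_equiv (N k) (gagliardo_norm N k).

Definition J_functional N (t : R) f : \bar R :=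
  maxe (N false f) (t%:E * N true f).

(* Only meant for 0 < r <= +oo. *)
Definition ell_norm (r : \bar R) (x : int -> \bar R) : \bar R :=
  match r with
  | p%:E => (\esum_(k in [set: int]) (`|x k| `^ p)) `^ p^-1
  | _ => ereal_sup (range (fun k => `|x k|))
  end.

(* The two tails of the bilateral series are summed independently. *)
Definition series_cvg_to N (u : int -> W) f : Prop :=
  sum_norm N
    (f - (\sum_(0 <= k < mn.1) u (Posz k) + \sum_(0 <= k < mn.2) u (Negz k)))%R
  @[mn --> (\oo, \oo)] --> 0.

(* (X_0, X_1)^J_{1,r,w} for 0 < r <= +oo. Convergence of the series already
   forces f to lie in X_0 + X_1. *)
Definition J_norm N (r : \bar R) (w : R -> R) f : \bar R :=
  ereal_inf
    [set ell_norm r (fun k : int =>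
           ((2 ^ (- k) * w (2 ^ k))%R)%:E * J_functional N (2 ^ k)%R (u k)) |
     u in [set u : int -> W |
            (forall k, cap_space N (u k)) /\ series_cvg_to N u f]].

End extended_norms.

Section duality.
Context {R : realType} {F : scalars}.
Local Notation K := (scalar_field R F).
Local Open Scope ereal_scope.

Section dual_space.
Context {V : lmodType K}.
Implicit Types (N : V -> \bar R) (g : V -> K).

(* A functional on {x | N x < +oo} is an arbitrary function on V of which only
   the values on that subspace are used. *)
Definition linear_on N g : Prop :=
  forall (c : K) (x y : V), N x < +oo -> N y < +oo ->
    g (c *: x + y)%R = (c * g x + g y)%R.

Definition continuous_on N g : Prop :=
  forall x, N x < +oo -> forall e : R, (0 < e)%R ->
  exists2 d : R, (0 < d)%R &
    forall y, N y < +oo -> N (y - x)%R < d%:E -> (modulus (g y - g x) < e)%R.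

Definition functional_norm N g : \bar R :=
  ereal_sup [set (modulus (g x))%:E | x in [set x | N x <= 1]].

(* Elements of the dual are identified with their restrictions f to D. When D
   is dense the extension g is unique, and the infimum is its norm; it is +oo
   if f has no continuous linear extension. *)
Definition dual_norm (D : set V) N (f : D -> K) : \bar R :=
  ereal_inf [set functional_norm N g |
    g in [set g | [/\ linear_on N g, continuous_on N g &
                      forall x : D, g (\val x) = f x]]].

End dual_space.

Section couples.
Variable A : banach_couple K.

Definition couple_norm (k : bool) (x : ambient A) : \bar R :=
  ereal_inf [set (real_part `|a|)%:E | a in emb A k @^-1` [set x]].

Definition couple_cap : set (ambient A) := cap_space couple_norm.

Definition regular_couple : Prop :=
  forall k, dense (emb A k @^-1` couple_cap).

Definition dual_couple_norm (k : bool) : (couple_cap -> K) -> \bar R :=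
  @dual_norm _ couple_cap (couple_norm k).

End couples.

End duality.

Section slow_variation.
Context {R : realType}.
Implicit Types (f g b : R -> R).

(* equivalence of functions on (0, +oo) *)
Definition equiv_pos f g : Prop :=
  exists2 C : R, 0 < C &
    forall t, 0 < t -> f t <= C * g t /\ g t <= C * f t.

Definition lebesgue_measurable_fun (D : set R) f : Prop :=
  @measurable_fun _ _ (caratheodory_type (@wlength R idfun)^*%mu) _ D f.

(* The monotonicity conditions force an extended-valued b with b <> 0 and
   b <> +oo (as functions) to be positive and finite everywhere, so b is
   real-valued here. Only the values on (0, +oo) matter. *)
Definition slowly_varying b : Prop :=
  [/\ lebesgue_measurable_fun `]0, +oo[ b,
      forall t, 0 < t -> 0 < b t &
      forall e, 0 < e ->
        (exists2 phi, {in `]0, +oo[ &, {homo phi : s t / s <= t}} &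
           equiv_pos (fun t => t `^ e * b t) phi) /\
        (exists2 phi, {in `]0, +oo[ &, {homo phi : s t / s <= t >-> t <= s}} &
           equiv_pos (fun t => t `^ (- e) * b t) phi)].

End slow_variation.

(* Main.v *)
(** Write Delta for the intersection of the couple, a_n = a(2^n), B_n = B(2^n)
    and p(x) = sum_n 2^-n a_n K(2^n, x), the sum running over all integers n.
    Since a = t B', the sum of the a_n over n <= k is comparable with B_k, and
    the sum of 2^-n a_n over n >= k is at most a constant times 2^-k B_k.

    A functional f on Delta lies in the J-space of the dual couple exactly when
    |f| <= M p on Delta: one direction follows from |u_k(x)| <= c K(2^-k, x) for
    the terms of a representation of f; the other is the Hahn-Banach theorem in
    the weighted l^1 sum of copies of Delta, each normed by K(2^n, .), applied to
    f carried by the diagonal.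

    It remains to compare p with the dual of the J-space. On the one hand p is
    bounded by the norm of the J-space, because q <= 1. On the other hand a
    functional bounded on the J-space satisfies |g(x)| <= M 2^-k B_k J(2^k, x)
    for all k, and a strong form of the fundamental lemma of interpolation,
    valid for mutually closed couples, turns this into |g| <= C M p. *)
Require Import Defs.
From HB Require Import structures.
From mathcomp Require Import all_boot all_order all_algebra.
From mathcomp Require Import complex.
From mathcomp Require Import all_classical all_reals all_analysis.
From mathcomp Require Import measurable_realfun ring lra zify.

Set Implicit Arguments.
Unset Strict Implicit.
Unset Printing Implicit Defensive.

Import Order.TTheory GRing.Theory Num.Theory.
Import numFieldTopology.Exports numFieldNormedType.Exports.

Local Open Scope classical_set_scope.
Local Open Scope ring_scope.

(** * The Hahn-Banach theorem with an extended seminorm *)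

(** The obstacle is the lower bound for p. Cutting x into dyadic blocks with J-functional O(K(2^k,
    x)) at every level k would bound |g(x)| by the sum of all 2^-k B_k K(2^k, x), and a can be far
    smaller than B: if B grows like a power of log t at infinity, a/B tends to 0. The cure is to cut
    x only at levels along which K(t, x)/t at least halves. Each B at such a level is comparable
    with the sum of the a_n below it; after the sums are exchanged, geometric decay leaves a
    multiple of p(x). All levels below the first cut then form a single block, whose norm in A_1
    must be controlled by the supremum of K(t, x)/t. That supremum bounds the Gagliardo norm up to a
    factor 2, and this is where closedness enters. The Hahn-Banach step calls for seminorms with
    infinite values, because an arbitrary family need not be summable in the weighted l^1 sum, and K
    itself is infinite off the sum of the couple. *)

Section hahn_banach_real.
Context {R : realType} {K : numFieldType} {V : lmodType K}.
Variables (i : {rmorphism R -> K}) (p : V -> \bar R).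
Hypothesis p_ge0 : forall x, (0 <= p x)%E.
Hypothesis pD : forall x y, (p (x + y) <= p x + p y)%E.
Hypothesis pZ : forall r x, (p (i r *: x) <= `|r|%:E * p x)%E.

Let linear_graph (G : set (V * R)) := forall r x y,
  G x -> G y -> G (i r *: x.1 + y.1, r * x.2 + y.2).
Let dominated (G : set (V * R)) := forall x, G x -> (x.2%:E <= p x.1)%E.

Let linear_graphD G x y : linear_graph G -> G x -> G y ->
  G (x.1 + y.1, x.2 + y.2).
Proof. by move=> lG Gx Gy; have := lG 1 _ _ Gx Gy; rewrite rmorph1 scale1r mul1r. Qed.

(** Obtained as (r - 1) x + x, so that [G] need not be known to contain 0. *)
Let linear_graphZ G r x : linear_graph G -> G x -> G (i r *: x.1, r * x.2).
Proof.
move=> lG Gx; have := lG (r - 1) _ _ Gx Gx.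
rewrite rmorphB rmorph1 scalerBl scale1r mulrBl mul1r.
by rewrite -[_ - x.1 + _]addrA -[_ - x.2 + _]addrA !addNr !addr0.
Qed.

Let pZ' r x : r != 0 -> (`|r|%:E * p x <= p (i r *: x))%E.
Proof.
move=> r0; have := pZ r^-1 (i r *: x).
rewrite scalerA -rmorphM mulVf// rmorph1 scale1r normfV => h.
have r0' : (0 < `|r|) by rewrite normr_gt0.
by rewrite -lee_pdivlMl.
Qed.

(* As p may be infinite, the symmetry of p matters: either p (x - v) is infinite
   on all of G, and then so is p (x + v), or both are finite somewhere. *)
Let one_step G v : G !=set0 -> linear_graph G -> dominated G ->
  exists c, forall x, G x ->
    ((x.2 - c)%:E <= p (x.1 - v) /\ (x.2 + c)%:E <= p (x.1 + v))%E.
Proof.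
move=> [g0 Gg0] lG dG.
have [[x0 [Gx0 x0v]]|novx] := pselect (exists x, G x /\ (p (x.1 - v) < +oo)%E); last first.
  have no x : G x -> p (x.1 - v) = +oo%E.
    move=> Gx; apply/eqP; rewrite eq_le leey/= leNgt; apply/negP => h.
    by apply: novx; exists x.
  exists 0 => x Gx; rewrite (no _ Gx) leey; split=> //.
  have := pZ (-1) (x.1 + v).
  rewrite normrN1 mul1e rmorphN1 scaleN1r opprD.
  have := no _ (linear_graphZ (-1) lG Gx); rewrite /= rmorphN1 scaleN1r => ->.
  by rewrite leye_eq => /eqP ->; rewrite leey.

pose L := [set l : R | exists x r, [/\ G x, p (x.1 - v) = r%:E & l = x.2 - r]].
have LU l x r : L l -> G x -> p (x.1 + v) = r%:E -> l <= r - x.2.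
  move=> [y [s [Gy ys ->]]] Gx xr.
  have := dG _ (linear_graphD lG Gy Gx); have := pD (y.1 - v) (x.1 + v).
  rewrite addrACA addNr addr0 xr ys -EFinD => h1 /le_trans/(_ h1).
  rewrite /= lee_fin; lra.
have fin x : (p x < +oo)%E -> exists r, p x = r%:E.
  by move: (p_ge0 x); case: (p x) => [r _ _|//|//]; exists r.
have L0 : L !=set0.
  by have [r hr] := fin _ x0v; exists (x0.2 - r), x0, r.
have Lsup : has_sup L.
  split=> //; have /fin [r hr] : (p (- x0.1 + v) < +oo)%E.
    apply: le_lt_trans x0v; have := pZ (-1) (x0.1 - v).
    by rewrite normrN1 mul1e rmorphN1 scaleN1r opprB addrC.
  have G0 : G (- x0.1, - x0.2).
    by have := linear_graphZ (-1) lG Gx0; rewrite rmorphN1 scaleN1r mulN1r.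
  by exists (r + x0.2) => l Ll; have := LU _ _ _ Ll G0 hr; rewrite opprK.
exists (sup L) => x Gx; split.
- case: (ltP (p (x.1 - v)) +oo%E) => [/fin[r xr]|]; last first.
    by rewrite leye_eq => /eqP ->; rewrite leey.
  have : x.2 - r <= sup L by apply: ub_le_sup; [exact: Lsup.2|exists x, r].
  by rewrite xr lee_fin; lra.
- case: (ltP (p (x.1 + v)) +oo%E) => [/fin[r xr]|]; last first.
    by rewrite leye_eq => /eqP ->; rewrite leey.
  have : sup L <= r - x.2 by apply: ge_sup => // l Ll; exact: LU.
  by rewrite xr lee_fin; lra.
Qed.

(** Scaling by 1/|a| turns a point x + a v into y + v or y - v with y in the domain of [G], so the
    two bounds of [one_step] cover every multiple of [v]. *)
Let one_step_graph G v : G !=set0 -> linear_graph G -> dominated G ->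
  exists c, let G' := [set (z.1.1 + i z.2 *: v, z.1.2 + z.2 * c) |
                       z in [set z : (V * R) * R | G z.1]] in
    linear_graph G' /\ dominated G'.
Proof.
move=> G0 lG dG; have [c cP] := one_step v G0 lG dG.
exists c => G'; split.
- move=> r _ _ [[[x s] a] /= Gx <-] [[[y t] b] /= Gy <-] /=.
  exists ((i r *: x + y, r * s + t), r * a + b); first exact: (lG r _ _ Gx Gy).
  rewrite /= rmorphD rmorphM scalerDl -scalerA !scalerDr; congr (_, _).
    by rewrite addrACA.
  by ring.
- move=> _ [[x a] /= Gx <-] /=.
  have [a0|a0|->] := ltgtP a 0; last first.
  + by rewrite rmorph0 scale0r mul0r !addr0; exact: dG.
  + have := (cP _ (linear_graphZ a^-1 lG Gx)).2 => /= h.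
    have := @lee_wpmul2l _ `|a|%:E _ _ _ h; rewrite lee_fin normr_ge0 => /(_ isT).
    have an0 : a != 0 by rewrite gt_eqF.
    move=> h1; have := le_trans h1 (pZ' _ an0).
    rewrite scalerDr scalerA -rmorphM mulfV// rmorph1 scale1r.
    by rewrite -EFinM gtr0_norm// mulrDr mulrA mulfV// mul1r.
  + have := (cP _ (linear_graphZ (- a^-1) lG Gx)).1 => /= h.
    have := @lee_wpmul2l _ `|- a|%:E _ _ _ h; rewrite lee_fin normr_ge0 => /(_ isT).
    have an0 : a != 0 by rewrite lt_eqF.
    have an0' : - a != 0 by rewrite oppr_eq0.
    move=> h1; have := le_trans h1 (pZ' _ an0').
    rewrite scalerBr scalerA -rmorphM mulrNN mulfV// rmorph1 scale1r rmorphN scaleNr opprK.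
    by rewrite -EFinM normrN ltr0_norm// mulrBr mulrA mulrNN mulfV// mul1r mulNr opprK.
Qed.

(* A dominated linear graph is automatically functional, since p 0 <= 0. *)
Lemma hahn_banach_real (D : set V) (f : V -> R) : D 0 ->
  (forall r x y, D x -> D y -> D (i r *: x + y)) ->
  (forall r x y, D x -> D y -> f (i r *: x + y) = r * f x + f y) ->
  (forall x, D x -> ((f x)%:E <= p x)%E) ->
  exists g : V -> R, [/\ forall r x y, g (i r *: x + y) = r * g x + g y,
    forall x, D x -> g x = f x & forall x, ((g x)%:E <= p x)%E].
Proof.
move=> D0 lD lf fp.
pose G0 : set (V * R) := [set (x, f x) | x in D].
(* Adding [G0] inside [P] makes the empty set admissible, and with it the union of the empty
   chain. *)
pose P (G : set (V * R)) := linear_graph (G `|` G0) /\ dominated (G `|` G0).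
have lG0 : linear_graph G0.
  by move=> r _ _ [x Dx <-] [y Dy <-] /=; exists (i r *: x + y); rewrite ?lf//; exact: lD.
have dG0 : dominated G0 by move=> _ [x Dx <-] /=; exact: fp.
have [|A [[lA dA] maxA]] := @Zorn_bigcup _ P.
  move=> C CP totC; split.
  - have subC X : C X -> X `|` G0 `<=` \bigcup_(X in C) X `|` G0.
      by move=> CX; apply: setSU => x Xx; exists X.
    move=> r x y [[X CX Xx]|Gx] [[Y CY Yy]|Gy].
    + have [XY|YX] := totC _ _ CX CY.
        by apply: (subC Y CY); apply: (CP Y CY).1; left => //; exact: XY.
      by apply: (subC X CX); apply: (CP X CX).1; left => //; exact: YX.
    + by apply: (subC X CX); apply: (CP X CX).1; [left|right].
    + by apply: (subC Y CY); apply: (CP Y CY).1; [right|left].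
    + by right; exact: lG0.
  - move=> x [[X CX Xx]|]; last exact: dG0.
    by apply: (CP X CX).2; left.
pose G := A `|` G0.
have G00 : G (0, 0).
  have : G (0, f 0) by right; exists 0.
  by move=> /(linear_graphZ 0 lA) /=; rewrite rmorph0 scale0r mul0r.
have tot v : exists s, G (v, s).
  apply: contrapT => nv.
  have [|c [lG' dG']] := one_step_graph v _ lA dA; first by exists (0, 0).
  set G' := [set _ | _ in _] in lG' dG'.
  have GG' : G `<=` G'.
    by move=> [x s] Gx; exists ((x, s), 0) => //=; rewrite rmorph0 scale0r mul0r !addr0.
  apply: (maxA G').
    split; first by move=> x Ax; apply: GG'; left.
    move=> G'A; apply: nv; exists c; left; apply: G'A.
    by exists ((0, 0), 1) => //=; rewrite rmorph1 scale1r mul1r !add0r.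
  have -> : P G' = (linear_graph G' /\ dominated G'); last by [].
  rewrite /P (_ : G' `|` G0 = G')//; apply/setUidPl => x Gx.
  by apply: GG'; right.
have fun_ v s t : G (v, s) -> G (v, t) -> s <= t.
  move=> Gs Gt; have := linear_graphD lA Gs (linear_graphZ (-1) lA Gt).
  rewrite /= rmorphN1 scaleN1r subrr mulN1r => /dA /= h.
  have := pZ 0 0; rewrite scaler0 normr0 mul0e => /(le_trans h).
  by rewrite lee_fin subr_le0.
have [g gP] := choice tot.
have gE v s : G (v, s) -> g v = s.
  by move=> Gs; apply/eqP; rewrite eq_le !(fun_ v)//.
exists g; split=> [r x y|x Dx|x]; last exact: (dA _ (gP x)).
- exact/gE/(lA r _ _ (gP x) (gP y)).
- by apply: gE; right; exists x.
Qed.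

End hahn_banach_real.

(** * Moduli of real and complex scalars, and extended seminorms *)

Section scalars.
Context {R : realType} {F : scalars}.
Local Notation K := (scalar_field R F).
Implicit Types x y z : K.

Lemma real_partD x y : real_part (x + y) = real_part x + real_part y.
Proof. by case: F x y => // -[? ?] [? ?]. Qed.

Lemma real_part0 : real_part (0 : K) = 0.
Proof. by case: F. Qed.

Lemma real_part_ge0 x : 0 <= x -> 0 <= real_part x.
Proof. by case: F x => //= -[a b]; rewrite lecE /= => /andP[]. Qed.

Lemma real_part_le x y : x <= y -> real_part x <= real_part y.
Proof. by case: F x y => //= -[a b] [c d]; rewrite lecE /= => /andP[]. Qed.

Lemma real_part_eq0 x : 0 <= x -> real_part x = 0 -> x = 0.
Proof. by case: F x => //= -[a b]; rewrite lecE /= => /andP[/eqP -> _] ->. Qed.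

Lemma real_partM x y : 0 <= x -> 0 <= y -> real_part (x * y) = real_part x * real_part y.
Proof.
case: F x y => //= -[a b] [c d]; rewrite !lecE /= => /andP[/eqP -> _] /andP[/eqP -> _].
by rewrite mulr0 subr0.
Qed.

Lemma modulus_ge0 x : 0 <= modulus x.
Proof. exact: real_part_ge0. Qed.

Lemma modulusD x y : modulus (x + y) <= modulus x + modulus y.
Proof. by rewrite /modulus -real_partD; exact/real_part_le/ler_normD. Qed.

Lemma modulusM x y : modulus (x * y) = modulus x * modulus y.
Proof. by rewrite /modulus normrM real_partM. Qed.

Lemma modulusN x : modulus (- x) = modulus x.
Proof. by rewrite /modulus normrN. Qed.

Lemma modulus0 : modulus (0 : K) = 0.
Proof. by rewrite /modulus normr0 real_part0. Qed.

Lemma modulus1 : modulus (1 : K) = 1.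
Proof. by rewrite /modulus normr1; case: F. Qed.

Lemma modulus_eq0 x : modulus x = 0 -> x = 0.
Proof. by move=> /(real_part_eq0 (normr_ge0 _)) /normr0_eq0. Qed.

Lemma modulus_surj (r : R) : 0 <= r -> exists x : K, modulus x = r.
Proof.
case: F => r0; first by exists r; exact: ger0_norm.
by exists r%:C%C; rewrite /modulus ger0_norm// lecE /= eqxx.
Qed.

Lemma modulus_sum (I : Type) (s : seq I) (P : pred I) (f : I -> K) :
  modulus (\sum_(i <- s | P i) f i) <= \sum_(i <- s | P i) modulus (f i).
Proof.
elim/big_ind2 : _ => [|a b c d ab cd|//]; first by rewrite modulus0.
by rewrite (le_trans (modulusD _ _))// lerD.
Qed.

End scalars.

Section eseminorm.
Context {R : realType} {F : scalars}.
Local Notation K := (scalar_field R F).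

(** One inequality suffices for homogeneity: scaling back gives the converse when c is nonzero, and
    c = 0 forces p 0 = 0 because 0 times +oo is 0. *)
Record eseminorm (V : lmodType K) (p : V -> \bar R) : Prop := Eseminorm {
  eseminorm_ge0 : forall x, (0 <= p x)%E ;
  eseminormD : forall x y, (p (x + y)%R <= p x + p y)%E ;
  eseminormZ : forall c x, (p (c *: x)%R <= (modulus c)%:E * p x)%E }.

Lemma eseminorm0 (V : lmodType K) (p : V -> \bar R) : eseminorm p -> p 0 = 0%E.
Proof.
case=> p0 _ pZ; apply/eqP; rewrite eq_le p0 andbT.
by have := pZ 0 0; rewrite modulus0 mul0e scaler0.
Qed.

Lemma eseminormN (V : lmodType K) (p : V -> \bar R) x : eseminorm p -> p (- x) = p x.
Proof.
move=> [_ _ pZ]; apply/eqP; rewrite eq_le.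
have := pZ (-1) x; have := pZ (-1) (- x).
by rewrite modulusN modulus1 !mul1e !scaleN1r opprK => -> ->.
Qed.

Lemma eseminormB (V : lmodType K) (p : V -> \bar R) x y : eseminorm p ->
  (p (x - y)%R <= p x + p y)%E.
Proof. by move=> sp; rewrite -[p y](eseminormN _ sp) eseminormD. Qed.

Lemma eseminorm_sum (V : lmodType K) (p : V -> \bar R) (I : Type) (s : seq I)
  (P : pred I) (f : I -> V) : eseminorm p ->
  (p (\sum_(i <- s | P i) f i)%R <= \sum_(i <- s | P i) p (f i))%E.
Proof.
move=> sp; elim/big_ind2 : _ => [|a b c d ab cd|//]; first by rewrite eseminorm0.
by rewrite (le_trans (eseminormD sp _ _))// leeD.
Qed.

Definition dominated_by (V : lmodType K) (p : V -> \bar R) (D : set V) (g : V -> K) :=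
  forall x, D x -> ((modulus (g x))%:E <= p x)%E.

Definition klinear_on (V : lmodType K) (D : set V) (g : V -> K) :=
  forall c x y, D x -> D y -> g (c *: x + y) = c * g x + g y.

End eseminorm.

Section hahn_banach.
Context {R : realType}.

Definition submodule {F : scalars} (V : lmodType (scalar_field R F)) (D : set V) :=
  D 0 /\ forall (c : scalar_field R F) x y, D x -> D y -> D (c *: x + y).

Let hb_real (V : lmodType (scalar_field R RealScalars)) (p : V -> \bar R)
  (D : set V) f :
  eseminorm p -> submodule D -> klinear_on D f -> dominated_by p D f ->
  exists g, [/\ klinear_on setT g, forall x, D x -> g x = f x & dominated_by p setT g].
Proof.
move=> sp [D0 lD] lf fp.
have [|x Dx|g [gl gf gp]] := @hahn_banach_real R R V idfun p
  (eseminorm_ge0 sp) (eseminormD sp) (eseminormZ sp) D f D0 lD.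
- by move=> r x y; exact: lf.
- by apply: le_trans (fp _ Dx); rewrite lee_fin ler_norm.
have g0 : g 0 = 0 by have := gl (-1) 0 0; rewrite /= scaler0 addr0; lra.
exists g; split=> // [c x y _ _|x _]; first exact: gl.
rewrite /modulus /=; case: (ger0P (g x)) => [//|_].
rewrite -(eseminormN _ sp); apply: le_trans (gp _).
by have := gl (-1) x 0; rewrite /= scaleN1r addr0 g0 addr0 mulN1r => ->.
Qed.

(** The real part of [f] extends to a real-linear [g] below [p], and h x = g x - i g (i x) is the
    complex-linear functional with real part [g]. Multiplying x by c = |h x| / h x rotates h x onto
    the positive half-line, where [g] and [h] agree, so the bound on [g] passes to |h x|. *)
Let hb_complex (V : lmodType R[i]) (p : V -> \bar R) (D : set V) (f : V -> R[i]) :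
  (forall x, 0 <= p x)%E -> (forall x y, p (x + y)%R <= p x + p y)%E ->
  (forall c x, p (c *: x)%R <= (complex.Re `|c|)%:E * p x)%E ->
  D 0 -> (forall c x y, D x -> D y -> D (c *: x + y)) ->
  (forall c x y, D x -> D y -> f (c *: x + y) = c * f x + f y) ->
  (forall x, D x -> ((complex.Re `|f x|)%:E <= p x)%E) ->
  exists g : V -> R[i], [/\ forall c x y, g (c *: x + y) = c * g x + g y,
    forall x, D x -> g x = f x & forall x, ((complex.Re `|g x|)%:E <= p x)%E].
Proof.
move=> p0 pD pZ D0 lD lf fp.
have [r x|r x y Dx Dy|r x y Dx Dy|x Dx|g [gl gf gp]] :=
  @hahn_banach_real R R[i] V (@real_complex R) p p0
  pD _ D (fun x => complex.Re (f x)) D0.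
- apply: le_trans (pZ _ _) _.
  by rewrite normc_def /= expr0n/= addr0 sqrtr_sqr.
- exact: lD.
- by rewrite lf//; case: (f x) (f y) => a b [a' b'] /=; rewrite mul0r subr0.
- apply: le_trans (fp _ Dx); rewrite lee_fin (le_trans (ler_norm _))//.
  by have := normc_ge_Re (f x); rewrite lecE /= => /andP[].
have gD x y : g (x + y) = g x + g y by have := gl 1 x y; rewrite rmorph1 scale1r mul1r.
have g0 : g 0 = 0 by have := gD 0 0; rewrite addr0; lra.
have gZ s x : g (s%:C%C *: x) = s * g x by have := gl s x 0; rewrite !addr0 g0 addr0.
have gC a b x : g ((a +i* b)%C *: x) = a * g x + b * g ('i%C *: x).
  rewrite -!gZ -gD scalerA -scalerDl; congr (g (_ *: _)).
  by rewrite [LHS]complexE /= [_ * 'i%C]mulrC.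
have gii x : g ('i%C *: ('i%C *: x)) = - g x.
  rewrite scalerA -expr2 sqr_i.
  by have := gZ (-1) x; rewrite rmorphN1 mulN1r.
pose h x : R[i] := (g x +i* - g ('i%C *: x))%C.
have hl c x y : h (c *: x + y) = c * h x + h y.
  case: c => a b; rewrite /h scalerDr !gD.
  have -> : 'i%C *: ((a +i* b)%C *: x) = (a +i* b)%C *: ('i%C *: x).
    by rewrite !scalerA [in LHS]mulrC.
  rewrite (gC a b x) (gC a b ('i%C *: x)) gii.
  by apply/eqP; rewrite eq_complex /=; apply/andP; split; apply/eqP; ring.
have h0 : h 0 = 0 by rewrite /h scaler0 g0 oppr0.
exists h; split=> //.
- move=> x Dx; rewrite /h gf// gf; last by rewrite -[_ *: _]addr0; exact: lD.
  have f0 : f 0 = 0.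
    have := lf 1 0 0 D0 D0; rewrite scaler0 addr0 mul1r.
    by move=> /(congr1 (fun z => z - f 0)); rewrite subrr addrK.
  rewrite -['i%C *: x]addr0 lf// f0 addr0.
  by case: (f x) => a b /=; congr (_ +i* _)%C; ring.
- move=> x; have [->|hx0] := eqVneq (h x) 0; first by rewrite normr0.
  pose c : R[i] := `|h x| / h x.
  have nc : complex.Re `|c| = 1.
    by rewrite /c normrM normfV normr_id mulfV// normr_eq0.
  have <- : g (c *: x) = complex.Re `|h x|.
    have -> : g (c *: x) = complex.Re (h (c *: x)) by [].
    by rewrite -[c *: x]addr0 hl h0 addr0 /c divfK.
  apply: le_trans (gp _) _; apply: le_trans (pZ _ _) _.
  by rewrite nc mul1e.
Qed.

Lemma hahn_banach {F : scalars} (V : lmodType (scalar_field R F)) (p : V -> \bar R)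
  (D : set V) f :
  eseminorm p -> submodule D -> klinear_on D f -> dominated_by p D f ->
  exists g, [/\ klinear_on setT g, forall x, D x -> g x = f x & dominated_by p setT g].
Proof.
case: F V p D f => [] V p D f; first exact: hb_real.
move=> [p0 pD pZ] [D0 lD] lf fp.
have [g [gl gf gp]] := @hb_complex V p D f p0 pD pZ D0 lD lf fp.
by exists g; split=> [c x y _ _|x Dx|x _]; [exact: gl|exact: gf|exact: gp].
Qed.

End hahn_banach.

(** * Integrals of Lebesgue measurable functions *)

Section completed.
Context {R : realType}.
Local Notation mu := (@lebesgue_measure R).
Local Notation cmu := (@completed_lebesgue_measure R).
Local Notation CT := (caratheodory_type (@wlength R idfun)^*%mu).

Lemma lebesgue_measurable_set (A : set R) : measurable A -> @measurable _ CT A.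
Proof. by move=> mA; exact: sub_caratheodory. Qed.

Lemma negligible_completed (A : set R) : mu.-negligible A -> cmu.-negligible A.
Proof.
by move=> [N [mN N0 AN]]; exists N; split => //; exact: lebesgue_measurable_set.
Qed.

(** The identity, measurable from the completed sigma-algebra to the Borel one, pushes the completed
    measure forward to Lebesgue measure; this is the change of variables along it. *)
Lemma ge0_integral_completed (A : set R) (g : R -> R) :
  measurable A -> measurable_fun A g -> (forall x, A x -> 0 <= g x) ->
  (\int[cmu]_(x in A) (g x)%:E = \int[mu]_(x in A) (g x)%:E)%E.
Proof.
move=> mA mg g0.
have mid : @measurable_fun _ _ CT (measurableTypeR R) setT (idfun : CT -> measurableTypeR R).
  by move=> _ Y mY; rewrite setTI; exact: lebesgue_measurable_set.
rewrite -(@ge0_integral_pushforward _ _ CT (measurableTypeR R) R _ mid cmu A (EFin \o g))//.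
- by apply/measurable_EFinP.
- by move=> x; rewrite inE => /g0; rewrite lee_fin.
Qed.

(* N is the union, over rational levels, of the null parts of the superlevel
   sets of f. *)
Lemma lebesgue_measurable_fun_version (D : set R) (f : R -> R) :
  measurable D -> lebesgue_measurable_fun D f ->
  exists N : set R, [/\ measurable N, mu N = 0 & measurable_fun (D `\` N) f].
Proof.
move=> mD mf.
pose e n : rat := odflt 0 (unpickle n).
have H (n : nat) : exists N : set R, [/\ measurable N, mu N = 0 &
   measurable ((D `&` f @^-1` `]ratr (e n), +oo[) `\` N)].
  have : completed_algebra_gen mu (D `&` f @^-1` `]ratr (e n), +oo[).
    rewrite -g_sigma_completed_algebra_genE completed_caratheodory_measurable.
    exact: (mf (lebesgue_measurable_set mD) `]ratr (e n), +oo[%classic (measurable_itv _)).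
  move=> [A mA [M [N [mN N0 MN]] AM]]; exists N; split=> //.
  rewrite -AM setDUl (_ : M `\` N = set0) ?setU0; first exact: measurableD.
  by apply/seteqP; split => // x [/MN].
have [N NP] := choice H.
have mN : measurable (\bigcup_n N n).
  by apply: bigcupT_measurable => n; have [] := NP n.
exists (\bigcup_n N n); split=> //.
- apply/negligibleP => //; apply: negligible_bigcup => n.
  by apply/negligibleP; have [] := NP n.
- apply: (measurability _ (RGenOInfty.measurableE R)) => _ [_ [y ->] <-].
  have -> : (D `\` \bigcup_n N n) `&` f @^-1` `]y, +oo[ =
     \bigcup_(n in [set n | y < ratr (e n)])
        (((D `&` f @^-1` `]ratr (e n), +oo[) `\` N n) `\` \bigcup_n N n).
    apply/seteqP; split => x /=.
    - move=> [[Dx nNx]]; rewrite in_itv/= andbT => /rat_in_itvoo[r].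
      rewrite in_itv/= => /andP[yr rx].
      have er : e (pickle r) = r by rewrite /e pickleK.
      exists (pickle r); rewrite /= er//; split=> //; split; last first.
        by move=> Nx; apply: nNx; exists (pickle r).
      by split=> //=; rewrite in_itv/= rx.
    - move=> [n /= yn [[[Dx]]]]; rewrite !in_itv/= !andbT => nx _ nN.
      by split=> //; exact: lt_trans nx.
  apply: bigcup_measurable => n _; apply: measurableD => //.
  by have [] := NP n.
Qed.

(** This is Lebesgue's differentiation theorem. Local integrability comes from the finiteness of
    [G]: as [f] vanishes to the left of 0, its integral over a compact set is at most G y for some
    y. *)
Lemma ae_is_derive_integral (f G : R -> R) :
  measurable_fun setT f -> (forall x, 0 <= f x) -> (forall x, x <= 0 -> f x = 0) ->
  (forall t, 0 < t -> ((G t)%:E = \int[mu]_(s in `]0%R, t[) (f s)%:E)%E) ->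
  {ae mu, forall x : R, 0 < x -> is_derive x 1 G (f x)}.
Proof.
move=> mf f0 fN fG.
have mfA A : measurable_fun A f by exact: measurable_funTS.
have GE t : 0 < t -> ((G t)%:E = \int[mu]_(s in `]0%R, t]) (f s)%:E)%E.
  by move=> t0; rewrite fG// integral_itv_bndo_bndc//; apply/measurable_EFinP; exact: mfA.
have intf y : mu.-integrable [set` Interval (BRight 0) (BRight y)] (EFin \o f).
  apply/integrableP; split; first by apply/measurable_EFinP; exact: mfA.
  have [y0|y0] := leP y 0; first by rewrite set_itv_ge ?integral_set0// bnd_simp -leNgt.
  under eq_integral do rewrite /= ger0_norm//.
  by rewrite -GE// ltry.
have locf : locally_integrable setT f.
  split=> // [|K _ cK]; first exact: openT.
  have [M [_ KM]] := compact_bounded cK.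
  pose y := `|M| + 1.
  have Ky x : K x -> x <= y.
    move=> Kx; apply: le_trans (ler_norm _) _; apply: KM Kx.
    by rewrite /y (le_lt_trans (ler_norm _))// ltrDl.
  have -> : (\int[mu]_(x in K) `|f x|%:E = \int[mu]_(x in K) ((EFin \o f) \_ `]0%R, +oo[) x)%E.
    apply: eq_integral => x _; rewrite patchE ger0_norm//; case: ifPn => //.
    by rewrite notin_setE/= in_itv/= andbT => /negP; rewrite -leNgt => /fN ->.
  have mK : measurable K by exact: compact_measurable.
  rewrite -integral_mkcondr.
  apply: (@le_lt_trans _ _ (\int[mu]_(x in `]0%R, y]) (EFin \o f) x)%E).
    apply: ge0_subset_integral => //=.
    - by apply: measurableI => //; exact: measurable_itv.
    - by apply/measurable_EFinP; exact: mfA.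
    - by move=> x _; rewrite lee_fin.
    - by move=> x [Kx] /=; rewrite !in_itv/= andbT => ->; rewrite Ky.
  by rewrite -GE ?ltry// /y ltr_wpDl.
have := FTC1 intf locf; set F := fun x => _.
have FG x : 0 < x -> F x = G x by move=> x0; rewrite /F /Rintegral -GE.
apply: filterS; first exact: (ae_filter_ringOfSetsType mu).
move=> x H x0; have [|dF Fx] := H; first exact: x0.
apply: (@near_eq_is_derive _ _ _ F).
  by near=> y; apply: FG; near: y; exact: lt_nbhsr.
by apply: (DeriveDef dF); rewrite -derive1E.
Unshelve. all: by end_near. Qed.

End completed.

(** * The function B^q as a primitive of b^q/s *)

Section primitive.
Context {R : realType}.
Local Notation mu := (@lebesgue_measure R).
Local Notation cmu := (@completed_lebesgue_measure R).
Local Notation CT := (caratheodory_type (@wlength R idfun)^*%mu).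
Variables (q : R) (b B : R -> R).
Hypothesis q0 : 0 < q.
Hypothesis mb : lebesgue_measurable_fun `]0, +oo[ b.
Hypothesis B0 : forall t, 0 < t -> 0 < B t.
Hypothesis BE : forall t, 0 < t ->
  ((B t `^ q)%:E = \int[cmu]_(s in `]0%R, t[) (b s `^ q / s)%:E)%E.

Let f s := b s `^ q / s.

Let f_ge0 s : 0 < s -> 0 <= f s.
Proof. by move=> s0; rewrite mulr_ge0 ?powR_ge0// invr_ge0 ltW. Qed.

Let pos : set R := `]0, +oo[%classic.

Let mpos : measurable pos. Proof. exact: measurable_itv. Qed.

Let mpowRV (D : set R) (g : R -> R) : measurable D -> D `<=` pos ->
  measurable_fun D g -> measurable_fun D (fun s => g s `^ q / s).
Proof.
move=> mD Dpos mg; apply: measurable_funM.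
  exact: (measurableT_comp (measurable_powR q)).
apply: (measurable_funS _ Dpos) => //.
apply: open_continuous_measurable_fun => [|x]; first exact: interval_open.
rewrite inE /pos /= in_itv/= andbT => x0.
by apply: inv_continuous; rewrite gt_eqF.
Qed.

Let mf : @measurable_fun _ _ CT _ pos f.
Proof.
move=> _.
have mpos' := lebesgue_measurable_set mpos.
have mV : measurable_fun pos (fun s : R => s^-1).
  apply: open_continuous_measurable_fun => [|x]; first exact: interval_open.
  rewrite inE /pos /= in_itv/= andbT => x0.
  by apply: inv_continuous; rewrite gt_eqF.
apply: (@measurable_funM _ CT R pos (fun s => b s `^ q) (fun s => s^-1)); last exact: mpos'.
  apply: (@measurableT_comp _ _ _ CT _ _ (@powR R ^~ q)); first exact: measurable_powR.
  exact: mb.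
by move=> _ Y mY; apply: lebesgue_measurable_set; exact: mV.
Qed.

(** The differentiation theorem is about Borel functions, while [b] is only Lebesgue measurable.
    Setting [f] to 0 on a null set and on the nonpositive half-line gives a Borel function on the
    line with the same integrals. *)
Let version : exists (f0 : R -> R) (N : set R), [/\ measurable N /\ mu N = 0,
  measurable_fun setT f0 /\ (forall x, 0 <= f0 x),
  (forall x, x <= 0 -> f0 x = 0),
  (forall x, 0 < x -> ~ N x -> f0 x = f x) &
  forall t, 0 < t -> ((B t `^ q)%:E = \int[mu]_(s in `]0%R, t[) (f0 s)%:E)%E].
Proof.
have [N [mN N0 mbN]] := lebesgue_measurable_fun_version mpos mb.
have mD : measurable (pos `\` N) by exact: measurableD.
have mfN : measurable_fun (pos `\` N) f by apply: mpowRV => // x [].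
have posE x : pos x = (0 < x) :> Prop by rewrite /pos /= in_itv/= andbT.
exists (f \_ (pos `\` N)), N; split=> //.
- split; first by apply/(measurable_restrictT _ _).1.
  move=> x; rewrite patchE; case: ifPn => //; rewrite inE => -[+ _].
  by rewrite posE => /f_ge0.
- move=> x x0; rewrite patchE; case: ifPn => //; rewrite inE => -[+ _].
  by rewrite posE ltNge x0.
- by move=> x x0 nN; rewrite patchE mem_set//; split=> //; rewrite posE.
- move=> t t0; rewrite BE//.
  have sub : `]0, t[ `<=` pos by move=> x; rewrite posE /= in_itv/= => /andP[].
  rewrite -[LHS]/(\int[cmu]_(s in `]0%R, t[) (f s)%:E)%E.
  rewrite (@ge0_negligible_integral _ CT _ _ `]0, t[ N); first last.
  - exact: N0.
  - by move=> x /sub; rewrite posE => /f_ge0.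
  - apply/measurable_EFinP; apply: (@measurable_funS _ _ CT _ pos) => //.
    exact: lebesgue_measurable_set.
  - exact: lebesgue_measurable_set.
  - exact: lebesgue_measurable_set.
  rewrite ge0_integral_completed; first last.
  - by move=> x [/sub + _]; rewrite posE => /f_ge0.
  - apply: (measurable_funS _ _ mfN) => //; exact: setSD.
  - by apply: measurableD => //; exact: measurable_itv.
  rewrite [RHS](@ge0_negligible_integral _ (measurableTypeR R) R mu `]0, t[ N)//; first last.
  - move=> x /sub; rewrite posE => x0; rewrite lee_fin patchE.
    by case: ifPn => // _; exact: f_ge0.
  - apply/measurable_EFinP; apply: measurable_funTS.
    by apply/(measurable_restrictT _ _).1.
  apply: eq_integral => x; rewrite inE => -[/sub px nx].
  by rewrite patchE mem_set.
Qed.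

(** Chain rule for B = (B^q)^(1/q) at the points where B^q has derivative b^q/s. The exceptional set
    joins that of the differentiation theorem with the null set on which the Borel version may
    differ from [f]. *)
Lemma ae_derive_primitive :
  {ae cmu, forall t : R, 0 < t ->
     derivable B t 1 /\ t * derive1 B t = q^-1 * B t `^ (1 - q) * b t `^ q}.
Proof.
have [f0 [N [[mN N0] [mf0 f0_ge0] f0N f0f f0B]]] := version.
have [M [mM M0 AM]] := ae_is_derive_integral mf0 f0_ge0 f0N f0B.
have : cmu.-negligible (M `|` N).
  apply: negligible_completed; apply: negligibleU; apply/negligibleP => //.
apply: negligibleS => x /= nx; apply: contrapT => /not_orP[nM nN].
apply: nx => x0.
have dBq : is_derive x 1 (fun t => B t `^ q) (f0 x).
  by apply: contrapT => nd; apply: nM; apply: AM => /= /(_ x0).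
rewrite f0f// in dBq.
have dB : is_derive x 1 B (q^-1 * (B x `^ q) `^ (q^-1 - 1) * f x).
  apply: (@near_eq_is_derive _ _ _ ((@powR R ^~ q^-1) \o (fun t => B t `^ q))).
    near=> t; rewrite /= -powRrM mulfV ?gt_eqF// powRr1// ltW// B0//.
    by near: t; exact: lt_nbhsr.
  apply: is_derive1_comp; apply: is_derive1_powR.
  by rewrite powR_gt0// B0.
split; first exact: ex_derive.
rewrite derive1E derive_val /f -powRrM mulrBr mulfV ?gt_eqF// mulr1.
by field; rewrite !gt_eqF.
Unshelve. all: by end_near. Qed.

(** Meant for dyadic intervals, on which slow variation keeps b^q/s within constant factors of its
    value at the left end. *)
Lemma primitive_increment s t m M : 0 < s -> s < t -> 0 <= m ->
  (forall u, s <= u < t -> m <= f u <= M) ->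
  m * (t - s) <= B t `^ q - B s `^ q <= M * (t - s).
Proof.
move=> s0 st m0 fmM.
have t0 := lt_trans s0 st.
have mI (i : interval R) : @measurable _ CT [set` i].
  by apply: lebesgue_measurable_set; exact: measurable_itv.
have sub : `[s, t[ `<=` pos.
  by move=> x; rewrite /pos /= !in_itv/= andbT => /andP[/(lt_le_trans s0)].
have sub' : `]0, t[ `<=` pos by move=> x; rewrite /pos /= !in_itv/= andbT => /andP[].
have mfA A : @measurable _ CT A -> A `<=` pos -> @measurable_fun _ _ CT _ A (EFin \o f).
  move=> mA Apos; apply/measurable_EFinP; apply: (@measurable_funS _ _ CT _ pos) => //.
  exact: lebesgue_measurable_set.
have E : ((B t `^ q)%:E = (B s `^ q)%:E + \int[cmu]_(u in `[s, t[) (f u)%:E)%E.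
  rewrite !BE// (@itv_bndbnd_setU _ _ _ (BLeft s)) ?bnd_simp//; last exact: ltW.
  rewrite (@ge0_integral_setU _ CT); first by [].
  - exact: mI.
  - exact: mI.
  - rewrite -itv_bndbnd_setU ?bnd_simp; [|exact: s0|exact: ltW].
    by apply: mfA => //; exact: mI.
  - rewrite -itv_bndbnd_setU ?bnd_simp//; last exact: ltW.
    by move=> x /sub'; rewrite /pos /= in_itv/= andbT => /f_ge0; rewrite lee_fin.
  - apply/disj_setPLR => x /=; rewrite !in_itv/= => /andP[_ xs].
    by apply/negP; rewrite negb_and -ltNge xs.
have cE c : (\int[cmu]_(u in `[s, t[) c%:E = (c * (t - s))%:E)%E.
  rewrite (@integral_cst _ CT)//=.
  rewrite -[cmu _]/(mu `[s, t[) lebesgue_measure_itv/= lte_fin st.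
  by rewrite -EFinD -EFinM.
have {}E : ((B t `^ q - B s `^ q)%:E = \int[cmu]_(u in `[s, t[) (f u)%:E)%E.
  move: E; case: (integral _ _ _) => [r| |]//; rewrite -EFinD => -[->].
  by rewrite addrAC subrr add0r.
rewrite -!lee_fin E -!cE; apply/andP; split.
- apply: (@ge0_le_integral _ CT).
  + exact: mI.
  + by move=> u _; rewrite lee_fin.
  + exact: measurable_cst.
  + by apply: mfA => //; exact: mI.
  + by move=> u /=; rewrite in_itv/= => /fmM /andP[]; rewrite lee_fin.
- apply: (@ge0_le_integral _ CT).
  + exact: mI.
  + by move=> u /sub; rewrite /pos /= in_itv/= andbT => /f_ge0; rewrite lee_fin.
  + by apply: mfA => //; exact: mI.
  + exact: measurable_cst.
  + by move=> u /=; rewrite in_itv/= => /fmM /andP[]; rewrite lee_fin.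
Qed.

(** The integral over ]0, 1] is finite, being B(1)^q, so the integrals over ]0, t[ shrink to 0 with
    t. *)
Lemma primitive_cvg0 (e : R) : 0 < e ->
  exists2 d, 0 < d & forall t, 0 < t < d -> B t `^ q < e.
Proof.
move=> e0; have [f0 [N [_ [mf0 f0_ge0] _ _ f0B]]] := version.
have mf0A (A : set (measurableTypeR R)) : measurable_fun A (EFin \o f0).
  by apply/measurable_EFinP; exact: measurable_funTS.
have E t : 0 < t -> ((B t `^ q)%:E = \int[mu]_(s in `[0%R, t]) (f0 s)%:E)%E.
  move=> t0; rewrite f0B// -integral_itv_obnd_cbnd; last exact: mf0A.
  by rewrite integral_itv_bndo_bndc//; exact: mf0A.
have int : mu.-integrable `[0, 1] (EFin \o f0).
  apply/integrableP; split=> //.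
  by under eq_integral do rewrite /= ger0_norm//; rewrite -E ?ltry.
have /cvgrPdist_lt/(_ _ e0) := parameterized_integral_cvg_left ltr01 int.
move=> [d /= d0 dP]; exists d => // t /andP[t0 td].
have := dP t; rewrite /ball /= !sub0r normrN gtr0_norm// => /(_ td).
rewrite normrN /parameterized_integral /Rintegral -E//=.
by rewrite ger0_norm// powR_ge0.
Qed.

End primitive.

(** * Sums of dyadic weights *)

Section esum_int.
Context {R : realType}.
Implicit Types (f : int -> \bar R).
Local Open Scope ereal_scope.

Lemma esum_int_le f k : (forall n, 0 <= f n) ->
  \esum_(n in [set n : int | (n <= k)%R]) f n = \sum_(0 <= j <oo) f (k - j%:Z)%R.
Proof.
move=> f0; rewrite nneseries_esumT//.
apply: (reindex_esum setT _ (fun j : nat => k - j%:Z)%R).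
split=> [j _|i j _ _ /= ij|n /= nk].
- by rewrite /= lerBlDr lerDl.
- lia.
- exists `|k - n|%N => //; rewrite gez0_abs ?subr_ge0//; lia.
Qed.

Lemma esum_int_ge f k : (forall n, 0 <= f n) ->
  \esum_(n in [set n : int | (k <= n)%R]) f n = \sum_(0 <= j <oo) f (k + j%:Z)%R.
Proof.
move=> f0; rewrite nneseries_esumT//.
apply: (reindex_esum setT _ (fun j : nat => k + j%:Z)%R).
split=> [j _|i j _ _ /= ij|n /= nk].
- by rewrite /= lerDl.
- lia.
- exists `|n - k|%N => //; rewrite gez0_abs ?subr_ge0//; lia.
Qed.

Lemma nneseries_le_ub (f : nat -> R) (M : R) : (forall j, (0 <= f j)%R) ->
  (forall N, (\sum_(0 <= j < N) f j <= M)%R) ->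
  \sum_(0 <= j <oo) (f j)%:E <= M%:E.
Proof.
move=> f0 fM; apply: lime_le.
  by apply: is_cvg_nneseries => n _ _; rewrite lee_fin.
by apply: nearW => N; rewrite sumEFin lee_fin.
Qed.

End esum_int.

(** All that the functional-analytic part retains of [B] and [b]. The field [wb_cvg0] makes the
    remainder at the end of a halving chain negligible; together with [wb_cvgN] it makes the two
    tails of the dual series vanish. *)
Record weight_bounds {R : realType} (B a : int -> R) (C : R) : Prop := WeightBounds {
  wb_C : 0 < C ;
  wb_B : forall k, 0 < B k ;
  wb_a : forall k, 0 < a k ;
  wb_upper : forall k, (\esum_(n in [set n : int | (n <= k)%R]) (a n)%:E <= (C * B k)%:E)%E ;
  wb_lower : forall k, ((B k)%:E <= C%:E * \esum_(n in [set n : int | (n <= k)%R]) (a n)%:E)%E ;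
  wb_tail : forall k, (\esum_(n in [set n : int | (k <= n)%R]) (2 ^ (- n) * a n)%:E <=
                       (C * (2 ^ (- k) * B k))%:E)%E ;
  wb_cvg0 : forall e, 0 < e -> exists k : int, forall n, k <= n -> 2 ^ (- n) * B n < e ;
  wb_cvgN : forall e, 0 < e -> exists k : int, forall n, n <= k -> B n < e }.

Section discrete.
Context {R : realType}.

Lemma telescope_int (B : int -> R) k N :
  \sum_(0 <= j < N) (B (k - j%:Z + 1) - B (k - j%:Z)) = B (k + 1) - B (k - N%:Z + 1).
Proof.
elim: N => [|N IH]; first by rewrite big_nil subr0 subrr.
rewrite big_nat_recr//= IH.
have -> : k - N.+1%:Z + 1 = k - N%:Z by lia.
by ring.
Qed.

(* a k is comparable with B (k + 1) - B k, so that the sums telescope. *)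
Lemma weight_boundsP (B a : int -> R) (C rho : R) : 0 < C -> 0 < rho < 1 ->
  (forall k, 0 < B k) -> (forall k, 0 < a k) ->
  (forall k, a k <= C * (B (k + 1) - B k)) ->
  (forall k, B (k + 1) - B k <= C * a k) ->
  (forall k, B (k + 1) <= C * B k) ->
  (forall e, 0 < e -> exists k, B k < e) ->
  (forall (k : int) (j : nat), 2 ^ (- (k + j%:Z)) * B (k + j%:Z) <= C * rho ^+ j * (2 ^ (- k) * B k)) ->
  exists C', weight_bounds B a C'.
Proof.
move=> C0 /andP[rho0 rho1] B0 a0 aB Ba BS Bcvg Bdecay.
have Bmono k (j : nat) : B (k - j%:Z) <= B k.
  elim: j => [|j IH]; first by rewrite subr0.
  apply: le_trans IH; have := aB (k - j.+1%:Z); have -> : k - j.+1%:Z + 1 = k - j%:Z by lia.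
  have := a0 (k - j.+1%:Z); nra.
pose C1 := C * C.
have upper k : (\esum_(n in [set n : int | (n <= k)%R]) (a n)%:E <= (C1 * B k)%:E)%E.
  rewrite esum_int_le; last by move=> n; rewrite lee_fin ltW.
  apply: nneseries_le_ub => [j|N]; first exact: ltW.
  apply: (@le_trans _ _ (C * \sum_(0 <= j < N) (B (k - j%:Z + 1) - B (k - j%:Z)))).
    by rewrite mulr_sumr; apply: ler_sum.
  rewrite telescope_int /C1 -mulrA ler_pM2l//; have := BS k.
  have := B0 (k - N%:Z + 1); lra.
(* Telescoping down from level k leaves a value of [B] at a low level; it tends to 0 and is absorbed
   by e. *)
have lower k : ((B k)%:E <= C%:E * \esum_(n in [set n : int | (n <= k)%R]) (a n)%:E)%E.
  rewrite esum_int_le; last by move=> n; rewrite lee_fin ltW.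
  apply/lee_addgt0Pr => e e0.
  have [n Bn] := Bcvg e e0.
  have BS' : B k <= B (k + 1) by have := Bmono (k + 1) 1; rewrite addrK.
  have [N BN] : exists N : nat, B (k - N%:Z) < e.
    have [kn|nk] := leP k n.
      exists 0%N; apply: le_lt_trans Bn; rewrite subr0.
      by have := Bmono n `|n - k|%N; rewrite gez0_abs ?subr_ge0// subKr.
    by exists `|k - n|%N; rewrite gez0_abs ?subr_ge0 1?ltW// subKr.
  have H : B k <= C * \sum_(0 <= j < N.+1) a (k - j%:Z) + e.
    apply: (@le_trans _ _ (\sum_(0 <= j < N.+1) (B (k - j%:Z + 1) - B (k - j%:Z)) + e)).
      rewrite telescope_int; have -> : k - N.+1%:Z + 1 = k - N%:Z by lia.
      by lra.
    by rewrite lerD2r mulr_sumr; apply: ler_sum.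
  apply: (@le_trans _ _ (C * \sum_(0 <= j < N.+1) a (k - j%:Z) + e)%:E).
    by rewrite lee_fin.
  rewrite EFinD leeD2r// EFinM -sumEFin; apply: lee_wpmul2l; first by rewrite lee_fin ltW.
  by apply: nneseries_lim_ge => j _ _; rewrite lee_fin ltW.
(* C1 comes from a_n <= C1 B_n, and C / (1 - rho) from summing the geometric decay of 2^-n B_n. *)
pose C2 := C1 * (C * (1 - rho)^-1).
have tail k : (\esum_(n in [set n : int | (k <= n)%R]) (2 ^ (- n) * a n)%:E <=
                       (C2 * (2 ^ (- k) * B k))%:E)%E.
  have aB' n : a n <= C1 * B n.
    apply: le_trans (aB n) _; rewrite /C1 -mulrA ler_pM2l//.
    by have := BS n; have := B0 n; lra.
  rewrite esum_int_ge; last by move=> n; rewrite lee_fin mulr_ge0// ltW// exprz_gt0.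
  apply: nneseries_le_ub => [j|N]; first by rewrite mulr_ge0// ltW// exprz_gt0.
  apply: (@le_trans _ _ (\sum_(0 <= j < N) (C1 * (C * (2 ^ (- k) * B k)) * rho ^+ j))).
    apply: ler_sum => j _.
    apply: (@le_trans _ _ (2 ^ (- (k + j%:Z)) * (C1 * B (k + j%:Z)))).
      by rewrite ler_pM2l ?exprz_gt0.
    have -> : C1 * (C * (2 ^ (- k) * B k)) * rho ^+ j = C1 * (C * rho ^+ j * (2 ^ (- k) * B k)) by ring.
    by rewrite mulrCA ler_pM2l ?Bdecay// /C1 mulr_gt0.
  rewrite -mulr_sumr.
  have geo : \sum_(0 <= j < N) rho ^+ j <= (1 - rho)^-1.
    rewrite big_mkord -[_^-1]mul1r ler_pdivlMr ?subr_gt0// mulrC.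
    rewrite -opprB mulNr -subrX1.
    by have : 0 <= rho ^+ N by [rewrite exprn_ge0// ltW]; lra.
  have -> : C2 * (2 ^ (- k) * B k) = C1 * (C * (2 ^ (- k) * B k)) * (1 - rho)^-1.
    by rewrite /C2; ring.
  by rewrite ler_pM2l// !mulr_gt0// exprz_gt0.
have C10 : 0 < C1 by rewrite mulr_gt0.
have C20 : 0 < C2 by rewrite !mulr_gt0// invr_gt0 subr_gt0.
have Bp k : 0 < 2 ^ (- k) * B k by rewrite mulr_gt0// exprz_gt0.
exists (C + C1 + C2); split=> //.
- by rewrite !addr_gt0.
- move=> k; apply: le_trans (upper k) _; rewrite lee_fin ler_pM2r//; lra.
- move=> k; apply: le_trans (lower k) _; apply: lee_wpmul2r.
    by apply: esum_ge0 => n _; rewrite lee_fin ltW.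
  by rewrite lee_fin; lra.
- move=> k; apply: le_trans (tail k) _; rewrite lee_fin ler_pM2r//; lra.
- move=> e e0.
  have M0 : 0 < C * (2 ^ (- (0 : int)) * B 0) by rewrite mulr_gt0.
  have [N _ HN] : \forall N \near \oo, rho ^+ N < e / (C * (2 ^ (- (0 : int)) * B 0)).
    have : (rho ^+ n @[n --> \oo] --> (0 : R))%classic.
      by apply: cvg_expr; rewrite gtr0_norm.
    move=> /cvgrPdist_lt /(_ (e / (C * (2 ^ (- (0 : int)) * B 0))) (divr_gt0 e0 M0)).
    by apply: filterS => n; rewrite sub0r normrN ger0_norm// exprn_ge0// ltW.
  exists N%:Z => -[n Nn|//].
  have := Bdecay 0 n; rewrite add0r => /le_lt_trans; apply.
  rewrite mulrAC mulrC -ltr_pdivlMr//; exact: HN.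
- move=> e e0; have [k Bk] := Bcvg e e0; exists k => n nk.
  apply: le_lt_trans Bk; have := Bmono k `|k - n|%N.
  by rewrite gez0_abs ?subr_ge0// subKr.
Qed.

End discrete.

(** * Slowly varying functions at dyadic points *)

Section slowly_varying_weights.
Context {R : realType}.

(** Comparing two values through the monotone function crosses the equivalence twice, hence the
    squares in the constant. *)
Lemma slowly_varyingP (b : R -> R) (e : R) : slowly_varying b -> 0 < e ->
  exists2 C, 0 < C & forall s t, 0 < s -> s <= t ->
    s `^ e * b s <= C * (t `^ e * b t) /\
    t `^ (- e) * b t <= C * (s `^ (- e) * b s).
Proof.
move=> [_ b0 sv] e0; have [[phi phim [C1 C10 phiP]] [psi psim [C2 C20 psiP]]] := sv e e0.
exists (C1 ^+ 2 + C2 ^+ 2) => [|s t s0 st]; first by rewrite addr_gt0// exprn_gt0.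
have t0 := lt_le_trans s0 st.
have pin (x : R) : 0 < x -> x \in `]0, +oo[ by move=> x0; rewrite in_itv/= x0.
have pos x y : 0 < x -> 0 <= x `^ y * b x by move=> x0; rewrite mulr_ge0 ?powR_ge0// ltW ?b0.
split.
- have := phim s t (pin _ s0) (pin _ t0) st.
  have := (phiP _ s0).1; have := (phiP _ t0).2; have := pos t e t0; rewrite /= => h1 h2 h3 h4.
  apply: (@le_trans _ _ (C1 ^+ 2 * (t `^ e * b t))); last by rewrite ler_wpM2r// lerDl sqr_ge0.
  by rewrite expr2 -mulrA; apply: le_trans h3 _; rewrite ler_pM2l//; exact: le_trans h4 h2.
- have := psim s t (pin _ s0) (pin _ t0) st.
  have := (psiP _ t0).1; have := (psiP _ s0).2; have := pos s (- e) s0; rewrite /= => h1 h2 h3 h4.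
  apply: (@le_trans _ _ (C2 ^+ 2 * (s `^ (- e) * b s))); last by rewrite ler_wpM2r// lerDr sqr_ge0.
  by rewrite expr2 -mulrA; apply: le_trans h3 _; rewrite ler_pM2l//; exact: le_trans h4 h2.
Qed.

(** Young's inequality x^q y^(1-q) <= q x + (1-q) y, with exponents 1/q and 1/(1-q); q = 1 is apart
    since the second exponent is then infinite. It bounds increments of B by those of B^q. *)
Lemma powR_diff_ge (q x y : R) : 0 < q <= 1 -> 0 < x -> 0 < y ->
  q * (y - x) <= y `^ (1 - q) * (y `^ q - x `^ q).
Proof.
move=> /andP[q0 q1] x0 y0.
have -> : y `^ (1 - q) * (y `^ q - x `^ q) = y - x `^ q * y `^ (1 - q).
  rewrite mulrBr -powRD ?(gt_eqF y0) ?implybT// subrK powRr1 ?ltW//.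
  by rewrite [in RHS]mulrC.
have [->|qn1] := eqVneq q 1.
  by rewrite subrr powRr0 (powRr1 (ltW x0)) mul1r mulr1.
have q1' : 0 < 1 - q by rewrite subr_gt0 lt_neqAle qn1.
have := @conjugate_powR R (x `^ q) (y `^ (1 - q)) q^-1 (1 - q)^-1 (powR_ge0 _ _) (powR_ge0 _ _).
rewrite !invr_gt0 => /(_ q0 q1'); rewrite !invrK -!powRrM !mulfV ?gt_eqF//.
rewrite (powRr1 (ltW x0)) (powRr1 (ltW y0)) => /(_ (subrKC _ _)); lra.
Qed.

Lemma dyadic_weight_bounds (q : R) (B b : R -> R) :
  0 < q <= 1 -> slowly_varying B -> slowly_varying b ->
  (forall t, 0 < t ->
     ((B t `^ q)%:E =
      \int[completed_lebesgue_measure]_(s in `]0%R, t[) (b s `^ q / s)%:E)%E) ->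
  exists C, weight_bounds (fun k : int => B (2 ^ k))
     (fun k : int => q^-1 * B (2 ^ k) `^ (1 - q) * b (2 ^ k) `^ q) C.
Proof.
move=> /[dup] q01 /andP[q0 q1] svB svb BE.
have [_ B0 _] := svB; have [mb b0 _] := svb.
have d0 (k : int) : 0 < 2 ^ k :> R by rewrite exprz_gt0.
have dS (k : int) : 2 ^ (k + 1) = 2 * 2 ^ k :> R by rewrite expfzDr// expr1z mulrC.
have [cb cb0 cbP] := slowly_varyingP svb ltr01.
have [cB cB0 cBP] := slowly_varyingP svB ltr01.
(* An exponent below 1 is needed for decay: if t^(-1/2) B(t) is almost decreasing, then 2^-n B(2^n)
   decays at least like powers of rho = 2^(-1/2). *)
have half0 : 0 < 2^-1 :> R by lra.
have [ch ch0 chP] := slowly_varyingP svB half0.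
(* Exponent 1 in [slowly_varyingP] lets [b] vary by a factor at most 2 cb on [2^k, 2^(k+1)[; [c] is
   the q-th power of that factor. *)
pose c := (2 * cb) `^ q.
have c0 : 0 < c by rewrite powR_gt0// mulr_gt0.
have increment (k : int) : c^-1 * b (2 ^ k) `^ q / 2 <= B (2 ^ (k + 1)) `^ q - B (2 ^ k) `^ q
   <= c * b (2 ^ k) `^ q.
  have st : 2 ^ k < 2 ^ (k + 1) :> R by rewrite dS; have := d0 k; lra.
  have E : 2 ^ (k + 1) - 2 ^ k = 2 ^ k :> R by rewrite dS; lra.
  have := @primitive_increment R q b B mb BE (2 ^ k) (2 ^ (k + 1))
     (c^-1 * b (2 ^ k) `^ q / 2 / 2 ^ k) (c * b (2 ^ k) `^ q / 2 ^ k) (d0 k) st.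
  rewrite E !divfK ?gt_eqF//; apply.
    by rewrite !mulr_ge0 ?invr_ge0 ?powR_ge0 ?(ltW (d0 k)) ?(ltW c0).
  move=> u /andP[ku uk].
  have u0 := lt_le_trans (d0 k) ku.
  have [h1 h2] := cbP _ _ (d0 k) ku.
  rewrite (powRr1 (ltW (d0 k))) (powRr1 (ltW u0)) in h1.
  rewrite (powR_inv1 (ltW (d0 k))) (powR_inv1 (ltW u0)) in h2.
  rewrite dS in uk.
  have bk : 0 < b (2 ^ k) by exact: b0.
  have bu : 0 < b u by exact: b0.
  have h1' : b (2 ^ k) <= 2 * cb * b u.
    rewrite -(ler_pM2l (d0 k)); apply: le_trans h1 _.
    have : 0 < cb * b u by rewrite mulr_gt0.
    nra.
  have h2' : b u <= 2 * cb * b (2 ^ k).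
    have := h2; rewrite ler_pdivrMl// => /le_trans; apply.
    rewrite [leLHS](_ : _ = (u / 2 ^ k) * (cb * b (2 ^ k))); last by ring.
    rewrite -[leRHS]mulrA ler_pM2r ?mulr_gt0// ler_pdivrMr//; exact: (ltW uk).
  have h1q : b (2 ^ k) `^ q <= c * b u `^ q.
    have cb2 : 0 < 2 * cb by rewrite mulr_gt0.
    rewrite /c -(powRM _ (ltW cb2)) 1?(ltW bu) 1?(ltW bk)//.
    by apply: ge0_ler_powR; rewrite ?nnegrE ?(ltW q0) ?(ltW bu) ?(ltW bk) ?mulr_ge0 ?(ltW cb0) ?(ltW bu) ?(ltW bk).
  have h2q : b u `^ q <= c * b (2 ^ k) `^ q.
    have cb2 : 0 < 2 * cb by rewrite mulr_gt0.
    rewrite /c -(powRM _ (ltW cb2)) 1?(ltW bu) 1?(ltW bk)//.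
    by apply: ge0_ler_powR; rewrite ?nnegrE ?(ltW q0) ?(ltW bu) ?(ltW bk) ?mulr_ge0 ?(ltW cb0) ?(ltW bu) ?(ltW bk).
  apply/andP; split.
  - rewrite -mulrA; apply: ler_pM.
    + by rewrite mulr_ge0 ?powR_ge0// invr_ge0 (ltW c0).
    + by rewrite mulr_ge0// invr_ge0 (ltW (d0 k)).
    + by rewrite ler_pdivrMl.
    + by rewrite -invfM lef_pV2 ?posrE ?mulr_gt0// (ltW uk).
  - apply: ler_pM; rewrite ?powR_ge0 ?invr_ge0 ?(ltW u0)//.
    by rewrite lef_pV2 ?posrE.
have Bk0 (k : int) : 0 < B (2 ^ k) by exact: B0.
have beta0 (k : int) : 0 < b (2 ^ k) `^ q by rewrite powR_gt0// b0.
have Bq_mono (k : int) : B (2 ^ k) <= B (2 ^ (k + 1)).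
  rewrite leNgt; apply/negP => h.
  have := gt0_ltr_powR q0 (ltW (Bk0 (k + 1))) (ltW (Bk0 k)) h.
  have /andP[h1 _] := increment k.
  have : 0 < c^-1 * b (2 ^ k) `^ q / 2 by rewrite !mulr_gt0// invr_gt0.
  lra.
have BS (k : int) : B (2 ^ (k + 1)) <= 2 * cB * B (2 ^ k).
  have st : 2 ^ k <= 2 ^ (k + 1) :> R by rewrite dS; have := d0 k; lra.
  have [_] := cBP _ _ (d0 k) st.
  rewrite (powR_inv1 (ltW (d0 k))) (powR_inv1 (ltW (d0 (k + 1)))) ler_pdivrMl// => /le_trans; apply.
  rewrite dS [leLHS](_ : _ = 2 * cB * B (2 ^ k))//.
  by field; rewrite gt_eqF.
pose a (k : int) := q^-1 * B (2 ^ k) `^ (1 - q) * b (2 ^ k) `^ q.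
have a0 k : 0 < a k by rewrite !mulr_gt0 ?invr_gt0// powR_gt0.
(* Here 1 - q >= 0 and B_k <= B_{k+1} give B_k^(1-q) (B_{k+1}^q - B_k^q) <= B_{k+1} - B_k. *)
have aB k : a k <= (q^-1 * (2 * c)) * (B (2 ^ (k + 1)) - B (2 ^ k)).
  rewrite /a -!mulrA ler_pM2l ?invr_gt0//.
  have /andP[h _] := increment k.
  apply: (@le_trans _ _ (2 * (c * (B (2 ^ k) `^ (1 - q) * (B (2 ^ (k + 1)) `^ q - B (2 ^ k) `^ q))))).
    rewrite [leRHS](_ : _ = B (2 ^ k) `^ (1 - q) * (2 * c * (B (2 ^ (k + 1)) `^ q - B (2 ^ k) `^ q))); last by ring.
    rewrite ler_pM2l ?powR_gt0//.
    have c20 : 0 < 2 * c by rewrite mulr_gt0.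
    by rewrite -ler_pdivrMl// invfM [X in X <= _](_ : _ = c^-1 * b (2 ^ k) `^ q / 2)//; ring.
  rewrite !ler_pM2l// mulrBr -[X in _ - X <= _]powRD; last by rewrite (gt_eqF (Bk0 k)) implybT.
  rewrite subrK (powRr1 (ltW (Bk0 k))) lerD2r.
  apply: (@le_trans _ _ (B (2 ^ (k + 1)) `^ (1 - q) * B (2 ^ (k + 1)) `^ q)).
    rewrite ler_pM2r ?powR_gt0//; apply: ge0_ler_powR; rewrite ?subr_ge0 ?nnegrE//.
    - exact: (ltW (Bk0 k)).
    - exact: (ltW (Bk0 (k + 1))).
  rewrite -powRD; last by rewrite (gt_eqF (Bk0 (k + 1))) implybT.
  by rewrite subrK (powRr1 (ltW (Bk0 (k + 1)))).
(* In the converse bound [powR_diff_ge] produces B_{k+1}^(1-q) in place of B_k^(1-q), at the cost of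
   the factor (2 cB)^(1-q). *)
pose C' := (2 * cB) `^ (1 - q) * c.
have C'0 : 0 < C' by rewrite mulr_gt0// powR_gt0// mulr_gt0.
have Ba k : B (2 ^ (k + 1)) - B (2 ^ k) <= C' * a k.
  have /andP[_ h] := increment k.
  rewrite -(ler_pM2l q0); apply: le_trans (powR_diff_ge q01 (Bk0 k) (Bk0 (k + 1))) _.
  have -> : q * (C' * a k) = ((2 * cB) `^ (1 - q) * B (2 ^ k) `^ (1 - q)) * (c * b (2 ^ k) `^ q).
    by rewrite /a /C'; field; rewrite gt_eqF.
  have cB2 : 0 < 2 * cB by rewrite mulr_gt0.
  rewrite -(powRM _ (ltW cB2) (ltW (Bk0 k))).
  apply: ler_pM => //; first exact: powR_ge0.
  - rewrite subr_ge0; apply: ge0_ler_powR => //; rewrite ?nnegrE ?(ltW q0)//.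
    + exact: (ltW (Bk0 k)).
    + exact: (ltW (Bk0 (k + 1))).
  - apply: ge0_ler_powR; rewrite ?subr_ge0 ?nnegrE//.
    + exact: (ltW (Bk0 (k + 1))).
    + by rewrite mulr_ge0 ?(ltW cB2) ?(ltW (Bk0 k)).
pose rho : R := 2 `^ (- 2^-1).
have rho01 : 0 < rho < 1.
  rewrite /rho powR_gt0//= powRN invf_lt1 ?powR_gt0//.
  have := @gt0_ltr_powR R 2^-1 half0 1 2; rewrite !nnegrE powR1; apply=> //.
  by rewrite ltr1n.
have Bdecay (k : int) (j : nat) :
    2 ^ (- (k + j%:Z)) * B (2 ^ (k + j%:Z)) <= ch * rho ^+ j * (2 ^ (- k) * B (2 ^ k)).
  have E : 2 ^ (k + j%:Z) = 2 ^ k * 2 ^+ j :> R by rewrite expfzDr.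
  have st : 2 ^ k <= 2 ^ (k + j%:Z) :> R.
    by rewrite E ler_peMr ?(ltW (d0 k))// exprn_ege1// ler1n.
  have [_ h] := chP _ _ (d0 k) st.
  have half x : 0 < x -> x^-1 = x `^ (- 2^-1) * x `^ (- 2^-1) :> R.
    move=> x0; rewrite -powRD; last by rewrite (gt_eqF x0) implybT.
    rewrite -(powR_inv1 (ltW x0)); congr (_ `^ _); lra.
  rewrite -!invr_expz (half _ (d0 (k + j%:Z))) (half _ (d0 k)) -[leLHS]mulrA.
  have E' : (2 ^ (k + j%:Z)) `^ (- 2^-1) = (2 ^ k) `^ (- 2^-1) * rho ^+ j :> R.
    rewrite E powRM ?(ltW (d0 k)) ?exprn_ge0//; congr (_ * _).
    rewrite -[2 ^+ j]powR_mulrn// -powRrM [_ * - _]mulrC powRrM -/rho.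
    by rewrite powR_mulrn// powR_ge0.
  apply: le_trans (ler_wpM2l (powR_ge0 _ _) h) _.
  by rewrite E' le_eqVlt; apply/orP; left; apply/eqP; ring.
have Bcvg e : 0 < e -> exists k : int, B (2 ^ k) < e.
  move=> e0; have eq0 : 0 < e `^ q by rewrite powR_gt0.
  have [d dd0 dP] := primitive_cvg0 mb BE eq0.
  have : ((2^-1 : R) ^+ n @[n --> \oo] --> (0 : R))%classic.
    by apply: cvg_expr; rewrite gtr0_norm// invf_lt1// ltr1n.
  move=> /cvgrPdist_lt /(_ d dd0) [N _ /(_ N (leqnn N))] /=.
  rewrite sub0r normrN gtr0_norm ?exprn_gt0// => Nd.
  have NE : (2^-1) ^+ N = 2 ^ (- N%:Z) :> R by rewrite exprVn -invr_expz.
  rewrite NE in Nd; exists (- N%:Z); rewrite ltNge; apply/negP => h.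
  have := dP (2 ^ (- N%:Z)); rewrite d0 Nd => /(_ isT).
  rewrite ltNge => /negP; apply; apply: ge0_ler_powR; rewrite ?nnegrE ?(ltW q0) ?(ltW e0)//.
  exact: (ltW (Bk0 (- N%:Z))).
have C10 : 0 < q^-1 * (2 * c) by rewrite mulr_gt0 ?invr_gt0 ?mulr_gt0.
pose C := q^-1 * (2 * c) + C' + 2 * cB + ch.
have C0 : 0 < C by rewrite !addr_gt0// mulr_gt0.
apply: (weight_boundsP C0 rho01) => //.
- move=> k; apply: le_trans (aB k) _; rewrite ler_wpM2r ?subr_ge0// /C.
  by have := mulr_gt0 (ltr0n R 2) cB0; lra.
- move=> k; apply: le_trans (Ba k) _; rewrite ler_wpM2r ?ltW// /C.
  by have := mulr_gt0 (ltr0n R 2) cB0; lra.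
- move=> k; apply: le_trans (BS k) _; rewrite ler_wpM2r ?ltW// /C.
  by have := mulr_gt0 (ltr0n R 2) cB0; lra.
- move=> k j; apply: le_trans (Bdecay k j) _.
  have /andP[r0 _] := rho01.
  rewrite ler_wpM2r// ?mulr_ge0 ?ltW ?exprz_gt0//.
  rewrite ltr_pM2r ?exprn_gt0// /C.
  by have := mulr_gt0 (ltr0n R 2) cB0; lra.
Qed.
End slowly_varying_weights.

Section esum_extra.
Context {R : realType}.
Local Open Scope ereal_scope.

Lemma esumZ_le (I : choiceType) (c : \bar R) (f : I -> \bar R) (D : set I) :
  0 <= c -> (forall i, 0 <= f i) ->
  \esum_(i in D) (c * f i) <= c * \esum_(i in D) f i.
Proof.
move=> c0 f0; apply: ge_ereal_sup => _ [X XD <-].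
rewrite -ge0_mule_fsumr//; apply: lee_wpmul2l => //.
by apply: esum_ge; exists X.
Qed.

Lemma esumZ (I : choiceType) (c : R) (f : I -> \bar R) (D : set I) :
  (0 <= c)%R -> (forall i, 0 <= f i) ->
  \esum_(i in D) (c%:E * f i) = c%:E * \esum_(i in D) f i.
Proof.
move=> c0 f0; apply/eqP; rewrite eq_le esumZ_le ?lee_fin//=.
have [->|cn0] := eqVneq c 0%R.
  by rewrite mul0e; apply: esum_ge0 => i _; rewrite mul0e.
have cp : (0 < c)%R by rewrite lt_neqAle eq_sym cn0.
rewrite muleC -lee_pdivlMr//.
apply: le_trans (_ : \esum_(i in D) ((c^-1)%:E * (c%:E * f i)) <= _).
  by apply: le_esum => i _; rewrite muleA -EFinM mulVf ?mul1e.
rewrite muleC; apply: esumZ_le => [|i]; first by rewrite lee_fin invr_ge0.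
by rewrite mule_ge0 ?lee_fin.
Qed.

Lemma esum_exchange (I J : choiceType) (f : I -> J -> \bar R) :
  (forall i j, 0 <= f i j) ->
  \esum_(i in setT) \esum_(j in setT) f i j =
  \esum_(j in setT) \esum_(i in setT) f i j.
Proof.
move=> f0; rewrite !esum_esum//.
apply: (reindex_esum _ _ (fun k : J * I => (k.2, k.1))).
split=> [k _|[i j] [i' j'] _ _ /= [-> ->]|[i j] _] //.
by exists (j, i).
Qed.

Lemma esum_subset (I : choiceType) (f : I -> \bar R) (D E : set I) :
  D `<=` E -> \esum_(i in D) f i <= \esum_(i in E) f i.
Proof.
move=> DE; apply: ge_ereal_sup => _ [X [finX XD] <-]; apply: esum_ge.
by exists X => //; split=> //; exact: subset_trans DE.
Qed.

Lemma esum_ge1 (I : choiceType) (f : I -> \bar R) (D : set I) (i : I) :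
  (forall i, 0 <= f i) -> D i -> f i <= \esum_(i in D) f i.
Proof.
move=> f0 Di; apply: esum_ge; exists [set i]; last by rewrite fsbig_set1.
by split=> [|_ ->]; [exact: finite_set1|].
Qed.

(** The splitting matches the two independent tails in [series_cvg_to]. *)
Lemma esum_split_int (f : int -> \bar R) : (forall k, 0 <= f k) ->
  \esum_(k in [set: int]) f k =
  \sum_(0 <= j <oo) f (Posz j) + \sum_(0 <= j <oo) f (Negz j).
Proof.
move=> f0; rewrite (esumID [set k : int | (0 <= k)%R])// !setTI; congr (_ + _).
  by rewrite esum_int_ge//; apply: eq_eseriesr => j _; rewrite add0r.
have -> : ~` [set k : int | (0 <= k)%R] = [set k | (k <= -1)%R].
  apply/seteqP; split=> k /=; [move=> /negP; lia|move=> h; apply/negP; lia].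
rewrite esum_int_le//; apply: eq_eseriesr => j _; congr f; lia.
Qed.

Lemma esum_opp (f : int -> \bar R) :
  \esum_(k in [set: int]) f (- k)%R = \esum_(k in [set: int]) f k.
Proof.
apply/esym/(reindex_esum setT setT (fun k : int => (- k)%R)).
split=> // [i j _ _ /oppr_inj//|k _]; exists (- k)%R => //=; exact: opprK.
Qed.

(** The inclusion of l^q in l^1: with T the sum of the y_i^q, each y_i^q is at most T, so y_i =
    (y_i^q)^((1-q)/q) y_i^q <= T^((1-q)/q) y_i^q, and the sum is at most T^(1/q). *)
Lemma esum_powR_le (I : choiceType) (q : R) (y : I -> \bar R) :
  (0 < q <= 1)%R -> (forall i, 0 <= y i) ->
  \esum_(i in setT) y i <= (\esum_(i in setT) (y i) `^ q) `^ q^-1.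
Proof.
move=> /andP[q0 q1] y0.
set T := \esum_(i in setT) _ `^ q.
have T0 : 0 <= T by apply: esum_ge0 => i _; exact: poweR_ge0.
have yT i : y i `^ q <= T by apply: (@esum_ge1 _ (fun i => y i `^ q)) => // j; exact: poweR_ge0.
have qV : (q^-1 != 0)%R by rewrite invr_eq0 gt_eqF.
move: T0 yT; case TE : T => [t| |//]; last by rewrite poweRyr ?leey.
rewrite lee_fin => t0 yt.
have e0 : (0 <= (1 - q) / q)%R by rewrite divr_ge0 ?subr_ge0// (ltW q0).
apply: (@le_trans _ _ (\esum_(i in setT) ((t `^ ((1 - q) / q))%:E * y i `^ q))).
  apply: le_esum => i _; move: (y0 i) (yt i); case: (y i) => [r|_|//]; last first.
    by rewrite poweRyr ?gt_eqF.
  rewrite !poweR_EFin -EFinM !lee_fin => r0 rt.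
  have [->|rn0] := eqVneq r 0%R; first by rewrite mulr_ge0 ?powR_ge0.
  have rp : (0 < r)%R by rewrite lt_neqAle eq_sym rn0.
  apply: (@le_trans _ _ (((r `^ q) `^ ((1 - q) / q)) * r `^ q)%R).
    rewrite -powRrM mulrCA mulfV ?gt_eqF// mulr1 -powRD ?rn0 ?implybT//.
    by rewrite subrK powRr1.
  by rewrite ler_wpM2r ?powR_ge0//; apply: ge0_ler_powR; rewrite ?nnegrE ?powR_ge0.
apply: le_trans (esumZ_le _ _ _) _.
- by rewrite lee_fin powR_ge0.
- by move=> i; exact: poweR_ge0.
rewrite -/T TE poweR_EFin -EFinM lee_fin.
have qE : (q^-1 = (1 - q) / q + 1)%R by field; rewrite gt_eqF.
rewrite [leRHS](_ : _ = t `^ ((1 - q) / q + 1))%R; last by rewrite -qE.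
have [->|tn0] := eqVneq t 0%R.
  by rewrite mulr0 powR_ge0.
by rewrite powRD ?tn0 ?implybT// powRr1.
Qed.

End esum_extra.

(** * The K-functional *)

Section eseminorm_constructions.
Context {R : realType} {F : scalars}.
Local Notation K := (scalar_field R F).
Local Open Scope ereal_scope.

Lemma eseminorm_esum (V : lmodType K) (I : choiceType) (w : I -> V -> \bar R) :
  (forall i, eseminorm (w i)) -> eseminorm (fun x => \esum_(i in setT) w i x).
Proof.
move=> sw; have w0 i x : 0 <= w i x by exact: eseminorm_ge0.
split=> [x|x y|c x].
- exact: esum_ge0.
- rewrite -esumD//; apply: le_esum => i _; exact: eseminormD.
- apply: (@le_trans _ _ (\esum_(i in setT) ((modulus c)%:E * w i x))).
    by apply: le_esum => i _; exact: eseminormZ.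
  by apply: esumZ_le; rewrite ?lee_fin ?modulus_ge0.
Qed.

Lemma eseminorm_scale (V : lmodType K) (c : R) (p : V -> \bar R) : (0 <= c)%R ->
  eseminorm p -> eseminorm (fun x => c%:E * p x).
Proof.
move=> c0 sp; split=> [x|x y|k x].
- by rewrite mule_ge0 ?lee_fin// (eseminorm_ge0 sp).
- rewrite -ge0_muleDr ?(eseminorm_ge0 sp)//.
  by apply: lee_wpmul2l; [rewrite lee_fin|exact: eseminormD].
- by rewrite muleCA; apply: lee_wpmul2l; [rewrite lee_fin|exact: eseminormZ].
Qed.

End eseminorm_constructions.

Section K_functional.
Context {R : realType} {F : scalars} {V : lmodType (scalar_field R F)}.
Local Notation K := (scalar_field R F).
Variable N : bool -> V -> \bar R.
Hypothesis sN : forall k, eseminorm (N k).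
Local Open Scope ereal_scope.

Let N_ge0 k x : 0 <= N k x. Proof. exact: eseminorm_ge0. Qed.

Definition K_functional (t : R) (x : V) : \bar R :=
  ereal_inf [set N false y.1 + t%:E * N true y.2 |
             y in [set y : V * V | x = (y.1 + y.2)%R]].

Lemma K_functional_le (t : R) (y z : V) :
  K_functional t (y + z)%R <= N false y + t%:E * N true z.
Proof. by apply: ereal_inf_lbound; exists (y, z). Qed.

Lemma K_functional_ge (t : R) (x : V) (r : \bar R) :
  (forall y z, x = (y + z)%R -> r <= N false y + t%:E * N true z) ->
  r <= K_functional t x.
Proof. by move=> H; apply: le_ereal_inf_tmp => _ [[y z] /= xyz <-]; exact: H. Qed.

Lemma K_functional_lt (t : R) (x : V) (r : \bar R) : (0 <= t)%R -> K_functional t x < r ->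
  exists y z, [/\ x = (y + z)%R, N false y < r & t%:E * N true z < r].
Proof.
move=> t0 /ereal_inf_lt[_ [[y z] /= xyz <-] yz]; exists y, z; split=> //.
- by apply: le_lt_trans yz; rewrite leeDl// mule_ge0// lee_fin.
- by apply: le_lt_trans yz; rewrite leeDr.
Qed.

Lemma eseminorm_K_functional t : (0 <= t)%R -> eseminorm (K_functional t).
Proof.
move=> t0.
have K0 : K_functional t 0%R = 0.
  apply/eqP; rewrite eq_le; apply/andP; split.
    have := K_functional_le t 0 0.
    by rewrite addr0 !(eseminorm0 (sN _)) mule0 adde0.
  by apply: K_functional_ge => y z _; rewrite adde_ge0// mule_ge0// lee_fin.
have Kge0 x : 0 <= K_functional t x.
  by apply: K_functional_ge => y z _; rewrite adde_ge0// mule_ge0// lee_fin.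
split=> [//|x y|c x].
- have [Kx|] := ltP (K_functional t x) +oo; last first.
    by rewrite leye_eq => /eqP ->; rewrite addye ?leey// gt_eqF// (lt_le_trans _ (Kge0 y)).
  have [Ky|] := ltP (K_functional t y) +oo; last first.
    by rewrite leye_eq => /eqP ->; rewrite addey ?leey// gt_eqF// (lt_le_trans _ (Kge0 x)).
  rewrite -leeBlDr; last by rewrite ge0_fin_numE.
  apply: K_functional_ge => x1 x2 xE.
  rewrite leeBlDr; last by rewrite ge0_fin_numE.
  rewrite addeC.
  have [xfin|] := ltP (N false x1 + t%:E * N true x2) +oo; last first.
    by rewrite leye_eq => /eqP ->; rewrite addey ?leey// gt_eqF// (lt_le_trans _ (Kge0 y)).
  have xge0 : 0 <= N false x1 + t%:E * N true x2 by rewrite adde_ge0// mule_ge0// lee_fin.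
  rewrite -leeBlDr; last by rewrite ge0_fin_numE.
  apply: K_functional_ge => y1 y2 yE.
  rewrite leeBlDr; last by rewrite ge0_fin_numE.
  have H : N false (x1 + y1)%R + t%:E * N true (x2 + y2)%R <=
      (N false x1 + t%:E * N true x2) + (N false y1 + t%:E * N true y2).
    rewrite addeACA; apply: leeD; first exact: eseminormD.
    rewrite -ge0_muleDr//; apply: lee_wpmul2l; first by rewrite lee_fin.
    exact: eseminormD.
  rewrite xE yE addrACA; apply: le_trans (K_functional_le _ _ _) _.
  by apply: le_trans H _; rewrite addeC.
- have [->|c0] := eqVneq c 0%R; first by rewrite scale0r K0 modulus0 mul0e.
  have mc0 : (0 < modulus c)%R.
    rewrite lt_neqAle modulus_ge0 andbT eq_sym.
    by apply: contra c0 => /eqP /modulus_eq0 ->.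
  rewrite muleC -lee_pdivrMr//; apply: K_functional_ge => x1 x2 ->.
  rewrite lee_pdivrMr//; rewrite scalerDr; apply: le_trans (K_functional_le _ _ _) _.
  rewrite ge0_muleDl//; last by rewrite mule_ge0// lee_fin.
  apply: leeD; first by rewrite muleC; exact: eseminormZ.
  rewrite -muleA; apply: lee_wpmul2l; first by rewrite lee_fin.
  by rewrite muleC; exact: eseminormZ.
Qed.

Lemma K_functional_le_false t x : K_functional t x <= N false x.
Proof.
have := K_functional_le t x 0.
by rewrite addr0 (eseminorm0 (sN _)) mule0 adde0.
Qed.

Lemma K_functional_le_true t x : K_functional t x <= t%:E * N true x.
Proof.
have := K_functional_le t 0 x.
by rewrite add0r (eseminorm0 (sN _)) add0e.
Qed.

Lemma K_functional_mono s t x : (s <= t)%R -> K_functional s x <= K_functional t x.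
Proof.
move=> st; apply: K_functional_ge => y z ->; apply: le_trans (K_functional_le _ _ _) _.
by apply: leeD => //; apply: lee_wpmul2r => //; rewrite lee_fin.
Qed.

Lemma K_functional_quasi c t x : (0 <= t)%R -> (1 <= c)%R ->
  K_functional (c * t) x <= c%:E * K_functional t x.
Proof.
move=> t0 c1; have c0 : (0 < c)%R by exact: lt_le_trans c1.
rewrite muleC -lee_pdivrMr//; apply: K_functional_ge => y z ->.
rewrite lee_pdivrMr//; apply: le_trans (K_functional_le _ _ _) _.
rewrite ge0_muleDl ?mule_ge0 ?lee_fin//; apply: leeD.
  by rewrite -[leLHS]mule1; apply: lee_wpmul2l; rewrite ?lee_fin.
by rewrite EFinM -muleA muleC.
Qed.

Lemma sum_normE x : sum_norm N x = K_functional 1 x.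
Proof. by congr ereal_inf; apply: eq_imagel => y _; rewrite mul1e. Qed.

Lemma J_functional_false t x : N false x <= J_functional N t x.
Proof. by rewrite /J_functional le_max lexx. Qed.

Lemma J_functional_true t x : t%:E * N true x <= J_functional N t x.
Proof. by rewrite /J_functional le_max lexx orbT. Qed.

Lemma J_functional_ge0 t x : 0 <= J_functional N t x.
Proof. exact: le_trans (N_ge0 _ _) (J_functional_false _ _). Qed.

Lemma submodule_cap : submodule (cap_space N).
Proof.
split=> [k|c x y Nx Ny k]; first by rewrite (eseminorm0 (sN _)).
apply: le_lt_trans (eseminormD (sN _) _ _) _.
rewrite lte_add_pinfty//; apply: le_lt_trans (eseminormZ (sN _) _ _) _.
by rewrite lte_mul_pinfty ?lee_fin ?modulus_ge0.
Qed.

End K_functional.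

(** * The fundamental lemma *)

Section chain.
Context {R : realType}.
Variables (kap : int -> R) (nu : nat -> int).
Hypothesis kap_ge0 : forall n, 0 <= kap n.
Hypothesis kap_anti : forall m n, m <= n -> kap n <= kap m.
Hypothesis nu_mono : forall j, nu j <= nu j.+1.
Hypothesis kap_half : forall j, 2 * kap (nu j.+1) <= kap (nu j).

Lemma halving_chain_sum n J :
  \sum_(0 <= j < J) (if n <= nu j then kap (nu j) else 0) <= 2 * kap n.
Proof.
case: J => [|J]; first by rewrite big_nil mulr_ge0.
(* Subtracting the last term closes the induction: adding kap (nu J.+1) is paid for by 2 kap (nu
   J.+1) <= kap (nu J). *)
suff : (n <= nu J -> \sum_(0 <= j < J.+1) (if n <= nu j then kap (nu j) else 0)
         <= 2 * kap n - kap (nu J)) /\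
       (nu J < n -> \sum_(0 <= j < J.+1) (if n <= nu j then kap (nu j) else 0) = 0).
  move=> [H1 H2]; have [nJ|nJ] := leP n (nu J).
    by apply: le_trans (H1 nJ) _; rewrite gerBl.
  by rewrite H2// mulr_ge0.
elim: J => [|J [IH1 IH2]].
  rewrite big_nat1; split=> [n0|n0]; last by rewrite leNgt n0.
  by rewrite n0; have := kap_anti n0; lra.
rewrite big_nat_recr//=; split=> [nJ|nJ].
  rewrite nJ; have [nJ'|nJ'] := leP n (nu J).
    by have := IH1 nJ'; have := kap_half J; lra.
  by rewrite IH2//; have := kap_anti nJ; lra.
have nJ' := le_lt_trans (nu_mono J) nJ.
by rewrite IH2// leNgt nJ addr0.
Qed.

(** A discrete summation by parts. Each B (nu j) is at most C times the sum of a_n over n <= nu j;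
    once the sums are exchanged, a_n multiplies the chain terms at levels nu j >= n, a geometric sum
    of size at most 2 kap n. *)
Lemma halving_chain_weight (B a : int -> R) (C : R) J : weight_bounds B a C ->
  ((\sum_(0 <= j < J) B (nu j) * kap (nu j))%:E <=
   (2 * C)%:E * \esum_(n in [set: int]) (a n * kap n)%:E)%E.
Proof.
move=> wb; have a0 n : 0 <= a n by rewrite ltW// (wb_a wb).
have C0 := wb_C wb.
pose h j n : R := if n <= nu j then kap (nu j) else 0.
have h0 j n : 0 <= h j n by rewrite /h; case: ifP.
apply: (@le_trans _ _ (C%:E * \esum_(n in [set: int]) (\sum_(0 <= j < J) (a n * h j n)%:E))%E).
  rewrite -sumEFin.
  apply: (@le_trans _ _ (\sum_(0 <= j < J) (C%:E * \esum_(n in [set: int]) (a n * h j n)%:E))%E).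
    apply: lee_sum => j _; rewrite mulrC EFinM.
    apply: (@le_trans _ _ ((kap (nu j))%:E * (C%:E * \esum_(n in [set n : int | (n <= nu j)%R]) (a n)%:E))%E).
      by apply: lee_wpmul2l; [rewrite lee_fin|exact: wb_lower].
    rewrite muleCA; apply: lee_wpmul2l; first by rewrite lee_fin ltW.
    rewrite esum_mkcond -esumZ// => [|n]; last by case: ifP; rewrite ?lee_fin.
    apply: le_esum => n _; rewrite /h; case: ifPn => [|_].
      by rewrite inE/= => ->; rewrite mulrC.
    by rewrite mule0 lee_fin mulr_ge0// -/(h j n).
  rewrite -ge0_sume_distrr; last by move=> j _; apply: esum_ge0 => n _; rewrite lee_fin mulr_ge0.
  apply: lee_wpmul2l; first by rewrite lee_fin ltW.
  by rewrite esum_sum// => n j _ _; rewrite lee_fin mulr_ge0.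
rewrite [(2 * C)%R]mulrC EFinM -muleA; apply: lee_wpmul2l; first by rewrite lee_fin ltW.
rewrite -esumZ// => [|n]; last by rewrite lee_fin mulr_ge0.
apply: le_esum => n _; rewrite sumEFin -EFinM lee_fin -mulr_sumr mulrCA.
by rewrite ler_wpM2l// halving_chain_sum.
Qed.

End chain.

Lemma addzS (m : int) (j : nat) : m + j.+1%:Z = m + j%:Z + 1.
Proof. lia. Qed.

Lemma addz_pred (m : int) (j : nat) : (0 < j)%N -> m + j.-1%:Z + 1 = m + j%:Z.
Proof. lia. Qed.

Lemma ler_addz1 (m : int) (j : nat) : (0 < j)%N -> m + 1 <= m + j%:Z.
Proof. lia. Qed.

Lemma ler_addzS (m n p : int) (j : nat) : m + j%:Z <= n -> n + 1 <= p -> m + j.+1%:Z <= p.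
Proof. lia. Qed.

Lemma ler_addz1W (m n : int) : m + 1 <= n -> m <= n.
Proof. lia. Qed.

Section dual_estimate.
Context {R : realType} {F : scalars} {V : lmodType (scalar_field R F)}.
Local Notation K := (scalar_field R F).
Variable N : bool -> V -> \bar R.
Hypothesis sN : forall k, eseminorm (N k).

Let d0 (n : int) : 0 < 2 ^ n :> R. Proof. by rewrite exprz_gt0. Qed.
Let dS (n : int) : 2 ^ (n + 1) = 2 * 2 ^ n :> R.
Proof. by rewrite expfzDr// expr1z mulrC. Qed.

Let half_pow (n : nat) : 2 ^ (- n%:Z) = (2^-1) ^+ n :> R.
Proof. by rewrite -invr_expz exprVn. Qed.

(* The second components of near-optimal decompositions of x at t = 2^-n are
   bounded in the norm N true and converge to x in the sum norm. *)
Lemma gagliardo_true_le (x : V) (l : R) : (N false x < +oo)%E -> 0 < l ->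
  (forall n : int, (K_functional N (2 ^ n) x <= (2 ^ n * l)%:E)%E) ->
  (gagliardo_norm N true x <= (2 * l)%:E)%E.
Proof.
move=> x0 l0 Kx.
(* The factor 2 leaves room for a decomposition that does not attain the infimum; this uses l >
   0. *)
have H (n : nat) : exists z, (N true z <= (2 * l)%:E)%E /\
    (N false (z - x)%R <= ((2^-1) ^+ n * (2 * l))%:E)%E.
  have Klt : (K_functional N (2 ^ (- n%:Z)) x < (2 ^ (- n%:Z) * (2 * l))%:E)%E.
    apply: le_lt_trans (Kx _) _; rewrite lte_fin ltr_pM2l//; lra.
  have [y [z [xE Ny Nz]]] := K_functional_lt sN (ltW (d0 _)) Klt.
  exists z; split.
    by move: Nz; rewrite EFinM lte_pmul2l ?lte_fin// => /ltW.
  have -> : z - x = - y by rewrite xE opprD addrCA subrr addr0.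
  by rewrite (eseminormN _ (sN false)) -half_pow; exact: ltW.
have [s sP] := choice H.
apply: ereal_inf_le; exists (ereal_sup (range (N true \o s))); last first.
  by apply: ge_ereal_sup => _ [n _ <-]; exact: (sP n).1.
exists s => //; split=> [n|]; first by apply: le_lt_trans (sP n).1 _; rewrite ltry.
apply: (@squeeze_cvge _ _ _ _ (fun=> 0%E) _ (fun n => ((2^-1) ^+ n * (2 * l))%:E)).
- apply: nearW => n; rewrite sum_normE; apply/andP; split.
    exact: (eseminorm_ge0 (eseminorm_K_functional sN ler01)).
  by apply: le_trans (K_functional_le_false sN _ _) _; exact: (sP n).2.
- exact: cvg_cst.
- apply: cvg_EFin; first by apply: nearW.
  rewrite -[X in _ --> X](mul0r (2 * l)); apply: cvgMl.
  by apply: cvg_expr; rewrite gtr0_norm// invf_lt1// ltr1n.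
Qed.

Variables (B a : int -> R) (C : R).
Hypothesis wb : weight_bounds B a C.

(** The seminorm p, a discretised integral of K(t, x)/t against dB(t). *)
Definition weighted_K (x : V) : \bar R :=
  \esum_(n in [set: int]) ((2 ^ (- n) * a n)%:E * K_functional N (2 ^ n) x)%E.

Variable Cg : R.
Hypothesis Cg0 : 0 < Cg.
Hypothesis closed_true : forall x, (N true x <= Cg%:E * gagliardo_norm N true x)%E.

Variables (g : V -> K) (M : R).
Hypothesis M0 : 0 <= M.
Hypothesis lg : klinear_on (cap_space N) g.
Hypothesis gJ : forall x, cap_space N x -> forall k : int,
  ((modulus (g x))%:E <= (M * (2 ^ (- k) * B k))%:E * J_functional N (2 ^ k) x)%E.

Let cap_B x y : cap_space N x -> cap_space N y -> cap_space N (x - y).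
Proof. by move=> Nx Ny; rewrite addrC -scaleN1r; apply: (submodule_cap sN).2. Qed.

Let gD x y : cap_space N x -> cap_space N y -> g (x + y) = g x + g y.
Proof. by move=> Nx Ny; have := lg 1 Nx Ny; rewrite scale1r mul1r. Qed.

(** The hypotheses say J(2^n, w) <= 2^n r, and the powers of 2 cancel in [gJ]. *)
Let g_le n w r : (N false w <= (2 ^ n * r)%:E)%E -> (N true w <= r%:E)%E ->
  modulus (g w) <= M * (B n * r).
Proof.
move=> w0 w1.
have Nw : cap_space N w by case; [apply: le_lt_trans w1 _|apply: le_lt_trans w0 _]; rewrite ltry.
rewrite -lee_fin; apply: le_trans (gJ Nw n) _.
have -> : M * (B n * r) = M * (2 ^ (- n) * B n) * (2 ^ n * r).
  by rewrite -invr_expz; field; rewrite gt_eqF.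
rewrite [leRHS]EFinM; apply: lee_wpmul2l.
  by rewrite lee_fin mulr_ge0// mulr_ge0// ltW// (wb_B wb).
rewrite /J_functional ge_max w0 /= EFinM; apply: lee_wpmul2l => //.
by rewrite lee_fin ltW.
Qed.

(* With kap n = K(2^n, x) / 2^n, nonincreasing and tending to 0, start from a
   level n0 where kap is at least half its supremum and follow a chain
   n0 = nu 0 < nu 1 < ... along which kap drops by a factor between 2 and 4.
   The element x is the sum of the near-optimal y (nu 0), the increments
   y (nu j.+1) - y (nu j), each with J-functional O(K) at level nu j.+1, and a
   negligible remainder. Mutual closedness is what bounds y (nu 0) in N true. *)
Lemma dual_estimate x : cap_space N x ->
  ((modulus (g x))%:E <= (M * ((4 * Cg + 16) * (2 * C)))%:E * weighted_K x)%E.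
Proof.
move=> Nx.
have K0 t y : 0 <= t -> (0 <= K_functional N t y)%E.
  by move=> t0; exact: (eseminorm_ge0 (eseminorm_K_functional sN t0)).
pose x0 := fine (N false x); pose x1 := fine (N true x).
have x0E : N false x = x0%:E by rewrite fineK// ge0_fin_numE ?(eseminorm_ge0 (sN _)).
have x1E : N true x = x1%:E by rewrite fineK// ge0_fin_numE ?(eseminorm_ge0 (sN _)).
have x0_ge0 : 0 <= x0 by rewrite -lee_fin -x0E (eseminorm_ge0 (sN _)).
have x1_ge0 : 0 <= x1 by rewrite -lee_fin -x1E (eseminorm_ge0 (sN _)).
pose kap n : R := fine (K_functional N (2 ^ n) x) / 2 ^ n.
have kapE n : K_functional N (2 ^ n) x = (2 ^ n * kap n)%:E.
  rewrite /kap mulrC divfK ?gt_eqF// fineK// ge0_fin_numE ?K0 ?(ltW (d0 n))//.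
  by apply: le_lt_trans (K_functional_le_false sN _ _) _.
have kap_ge0 n : 0 <= kap n.
  by rewrite -(pmulr_rge0 _ (d0 n)) -lee_fin -kapE K0// ltW.
have kap_x1 n : kap n <= x1.
  by have := K_functional_le_true sN (2 ^ n) x; rewrite kapE x1E -EFinM lee_fin ler_pM2l.
have kap_x0 n : 2 ^ n * kap n <= x0.
  by have := K_functional_le_false sN (2 ^ n) x; rewrite kapE x0E lee_fin.
have kapS1 n : kap (n + 1) <= kap n.
  have := @K_functional_quasi _ _ _ _ sN 2 (2 ^ n) x (ltW (d0 n)).
  rewrite ler1n -dS !kapE -EFinM lee_fin => /(_ isT).
  by rewrite [2 * (_ * _)]mulrA -dS ler_pM2l.
have kapS2 n : kap n <= 2 * kap (n + 1).
  have : (K_functional N (2 ^ n) x <= K_functional N (2 ^ (n + 1)) x)%E.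
    by apply: K_functional_mono => //; rewrite dS; have := d0 n; lra.
  by rewrite !kapE lee_fin dS [2 * 2 ^ n]mulrC -mulrA ler_pM2l.
have kap_anti m n : m <= n -> kap n <= kap m.
  move=> mn; have -> : n = m + `|n - m|%N%:Z by rewrite gez0_abs ?subr_ge0// subrKC.
  elim: `|n - m|%N => [|j IH]; first by rewrite addr0.
  by apply: le_trans IH; rewrite addzS.
have wE : weighted_K x = \esum_(n in [set: int]) (a n * kap n)%:E.
  apply: eq_esum => n _; rewrite kapE -EFinM; congr EFin.
  by rewrite -invr_expz; field; rewrite gt_eqF.
have w_ge0 : (0 <= weighted_K x)%E.
  by rewrite wE; apply: esum_ge0 => n _; rewrite lee_fin mulr_ge0// ltW// (wb_a wb).
(* Closedness recovers the norm of x in A_1, up to a constant, from an upper bound for kap. *)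
have gag l : 0 < l -> (forall n, kap n <= l) -> x1 <= Cg * (2 * l).
  move=> l0 kl; rewrite -lee_fin -x1E; apply: le_trans (closed_true _) _.
  rewrite [leRHS]EFinM; apply: lee_wpmul2l; first by rewrite lee_fin ltW.
  by apply: gagliardo_true_le => // n; rewrite kapE lee_fin ler_pM2l.
have C0 := wb_C wb.
(* The first block costs at most 4 Cg + 2: kap <= 2 kap n0 enters [gag], which doubles it again, and
   y n0 differs from x by 2 kap n0 in A_1. An increment costs at most 10, namely 2 kap (nu J) <= 8
   kap (nu J.+1) plus 2 kap (nu J.+1). So 16 leaves room for both. *)
pose D := 4 * Cg + 16.
have D0 : 0 < D by rewrite /D addr_gt0// mulr_gt0.
have small c e : 0 <= c -> 0 < e -> exists k : int, forall n, k <= n ->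
    M * (B n * (c / 2 ^ n)) < e.
  move=> c0 e0; have Mc : 0 < M * c + 1 by rewrite ltr_wpDl ?mulr_ge0.
  have [k kP] := wb_cvg0 wb (divr_gt0 e0 Mc); exists k => n kn.
  have Bn0 : 0 < 2 ^ (- n) * B n by rewrite mulr_gt0 ?(wb_B wb).
  have := kP n kn; rewrite ltr_pdivlMr// mulrDr mulr1 => h.
  have -> : M * (B n * (c / 2 ^ n)) = 2 ^ (- n) * B n * (M * c).
    by rewrite -invr_expz; ring.
  lra.
(* If kap vanishes identically, [gag] with l = x1 / (4 Cg) would give x1 <= x1 / 2 for positive x1.
   Hence N true x = 0, and testing g at ever higher levels gives g x = 0. *)
have [kz|/existsNP [m km]] := pselect (forall n, kap n = 0).
  have x1_0 : x1 <= 0.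
    rewrite leNgt; apply/negP => x1p.
    have l0 : 0 < x1 / (4 * Cg) by rewrite divr_gt0// mulr_gt0.
    have := gag _ l0 (fun n => _); rewrite [X in _ <= X](_ : _ = x1 / 2); last first.
      by field; rewrite gt_eqF.
    have kl n : kap n <= x1 / (4 * Cg) by rewrite kz ltW.
    move=> /(_ kl); lra.
  apply: (@le_trans _ _ 0%E); last by rewrite mule_ge0// lee_fin !mulr_ge0// ltW.
  rewrite lee_fin; apply/ler_addgt0Pr => e e0; rewrite add0r.
  have [k /(_ k (lexx _)) /ltW] := small x0 e x0_ge0 e0.
  apply: le_trans; apply: g_le.
    by rewrite x0E lee_fin mulrCA mulfV ?mulr1// gt_eqF.
  by rewrite x1E lee_fin (le_trans x1_0)// divr_ge0// ltW.
have kap_pos n : 0 < kap n.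
  have kapm : 0 < kap m by rewrite lt_neqAle eq_sym kap_ge0 andbT; apply/eqP.
  have [nm|/ltW mn] := leP n m; first exact: lt_le_trans (kap_anti _ _ nm).
  have -> : n = m + `|n - m|%N%:Z by rewrite gez0_abs ?subr_ge0// subrKC.
  elim: `|n - m|%N => [|j IH]; first by rewrite addr0.
  have := kapS2 (m + j%:Z); rewrite addzS; lra.
have [n0 n0P] : exists n0, forall n, kap n <= 2 * kap n0.
  have ub : has_sup (range kap).
    by split; [exists (kap 0), 0|exists x1 => _ [n _ <-]].
  have L0 : 0 < sup (range kap).
    by apply: lt_le_trans (kap_pos 0) _; apply: ub_le_sup; [exact: ub.2|exists 0].
  have [_ [n0 _ <-] n0L] := sup_adherent (divr_gt0 L0 (ltr0n R 2)) ub.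
  exists n0 => n; have : kap n <= sup (range kap) by apply: ub_le_sup; [exact: ub.2|exists n].
  lra.
have x1_le : x1 <= 4 * Cg * kap n0.
  have := gag (2 * kap n0); rewrite pmulr_rgt0// => /(_ (kap_pos _) n0P); lra.
have decomp n : exists y, [/\ cap_space N y, (N false y <= (2 ^ n * (2 * kap n))%:E)%E &
    (N true (x - y)%R <= (2 * kap n)%:E)%E].
  have Klt : (K_functional N (2 ^ n) x < (2 ^ n * (2 * kap n))%:E)%E.
    by rewrite kapE lte_fin ltr_pM2l//; have := kap_pos n; lra.
  have [y [z [xE Ny Nz]]] := K_functional_lt sN (ltW (d0 _)) Klt.
  have Nz' : (N true z < (2 * kap n)%:E)%E by move: Nz; rewrite EFinM lte_pmul2l ?lte_fin.
  have zE : x - y = z by rewrite xE addrC addKr.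
  exists y; split; [|exact: ltW|by rewrite zE ltW].
  case; last by apply: lt_trans Ny _; rewrite ltry.
  have -> : y = x - z by rewrite xE addrK.
  apply: le_lt_trans (eseminormB _ _ (sN true)) _.
  by rewrite lte_add_pinfty ?Nx// (lt_trans Nz')// ltry.
have [y yP] := choice decomp.
have next n : exists n', [/\ n + 1 <= n', 2 * kap n' <= kap n & kap n <= 4 * kap n'].
  have [j0 j0P] : exists j : nat, 2 * kap (n + j%:Z) <= kap n.
    have x0p : 0 < 2 * x0 + 1 by have := x0_ge0; lra.
    have e0 : 0 < kap n * 2 ^ n / (2 * x0 + 1) by rewrite divr_gt0// mulr_gt0.
    have : ((2^-1 : R) ^+ j @[j --> \oo] --> (0 : R))%classic.
      by apply: cvg_expr; rewrite gtr0_norm// invf_lt1// ltr1n.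
    move=> /cvgrPdist_lt /(_ _ e0) [j _ /(_ j (leqnn j))] /=.
    rewrite sub0r normrN gtr0_norm ?exprn_gt0// -half_pow ltr_pdivlMr// => jP.
    exists j; have := kap_x0 (n + j%:Z); rewrite expfzDr// => h.
    have E : 2 ^ j%:Z * 2 ^ (- j%:Z) = 1 :> R by rewrite -expfzDr// subrr expr0z.
    have h' : kap (n + j%:Z) * 2 ^ n <= x0 * 2 ^ (- j%:Z).
      have -> : kap (n + j%:Z) * 2 ^ n = 2 ^ n * 2 ^ j%:Z * kap (n + j%:Z) * 2 ^ (- j%:Z).
        have G (u v w z : R) : v * w = 1 -> z * u = u * v * z * w.
          by move=> vw; rewrite -[LHS]mulr1 -vw; ring.
        exact: G.
      by rewrite ler_pM2r.
    rewrite -(ler_pM2r (d0 n)); have := d0 (- j%:Z); nra.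
  (* At the least j for which kap has halved, it had not halved at j - 1, and one dyadic step loses
     at most a factor 2; hence the 4. *)
  pose P j := 2 * kap (n + j%:Z) <= kap n.
  have exP : exists j, P j by exists j0.
  case: (ex_minnP exP) => j Pj jmin.
  have jp : (0 < j)%N.
    by rewrite lt0n; apply/eqP => j_0; move: Pj; rewrite /P j_0 addr0; have := kap_pos n; lra.
  exists (n + j%:Z); split=> //; first exact: ler_addz1.
  have : ~~ P j.-1 by apply/negP => /jmin; rewrite leqNgt ltn_predL jp.
  rewrite /P -ltNge; have := kapS2 (n + j.-1%:Z).
  by rewrite addz_pred//; lra.
have [nx nxP] := choice next.
pose nu j := iter j nx n0.
have nuS j : nu j.+1 = nx (nu j) by [].
have nu_ge j : n0 + j%:Z <= nu j.
  elim: j => [|j IH]; first by rewrite addr0.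
  by rewrite nuS; have [h _ _] := nxP (nu j); exact: ler_addzS h.
have main J : modulus (g (y (nu J))) <= M * (D * \sum_(0 <= j < J.+1) B (nu j) * kap (nu j)).
  elim: J => [|J IH].
    rewrite big_nat1; have -> : D * (B (nu 0%N) * kap (nu 0%N)) = B n0 * (D * kap n0).
      by rewrite mulrCA.
    have [_ y0 y1] := yP n0; have kp := kap_pos n0.
    apply: g_le.
      apply: le_trans y0 _; rewrite lee_fin ler_pM2l// ler_pM2r// /D.
      by have := Cg0; lra.
    have -> : y n0 = x - (x - y n0) by rewrite subKr.
    apply: le_trans (eseminormB _ _ (sN true)) _; apply: le_trans (leeD (lexx _) y1) _.
    by rewrite x1E -EFinD lee_fin /D; have := x1_le; nra.
  rewrite big_nat_recr//= mulrDr mulrDr.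
  have [y0c y00 y01] := yP (nu J); have [y1c y10 y11] := yP (nu J.+1).
  have -> : y (nu J.+1) = y (nu J) + (y (nu J.+1) - y (nu J)) by rewrite subrKC.
  rewrite gD//; last exact: cap_B.
  apply: le_trans (modulusD _ _) _; apply: lerD => //.
  have [h1 h2 h3] := nxP (nu J); rewrite -nuS in h1 h2 h3.
  have kp := kap_pos (nu J.+1).
  have -> : D * (B (nu J.+1) * kap (nu J.+1)) = B (nu J.+1) * (D * kap (nu J.+1)).
    by rewrite mulrCA.
  have D16 : 16 <= D by rewrite /D; have := Cg0; lra.
  apply: g_le.
    apply: le_trans (eseminormB _ _ (sN false)) _; apply: le_trans (leeD y10 y00) _.
    rewrite -EFinD lee_fin.
    have : 2 ^ nu J * kap (nu J) <= 2 ^ nu J.+1 * kap (nu J.+1).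
      rewrite -lee_fin -!kapE; apply: K_functional_mono => //.
      by rewrite ler_eXz2l ?ltr1n//; exact: ler_addz1W.
    have := mulr_gt0 (d0 (nu J.+1)) kp; nra.
  (* In A_0 the two pieces are bounded separately; in A_1 only the complements x - y are under
     control, so the increment is rewritten through them. *)
  have -> : y (nu J.+1) - y (nu J) = (x - y (nu J)) - (x - y (nu J.+1)).
    by rewrite opprB [RHS]addrC addrA subrK.
  apply: le_trans (eseminormB _ _ (sN true)) _; apply: le_trans (leeD y01 y11) _.
  by rewrite -EFinD lee_fin; nra.
apply/lee_addgt0Pr => e e0.
(* The remainder x - y (nu J) has norm at most x0 + 2 x0 in A_0 and at most 2 kap (nu J) <= 2 x0 /
   2^(nu J) in A_1; 3 x0 serves for both. *)
have [k kP] := small (3 * x0) e (mulr_ge0 (ler0n _ 3) x0_ge0) e0.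
pose J := `|k - n0|%N.
have kJ : k <= nu J.
  by apply: le_trans (nu_ge J); rewrite -lerBlDl /J; exact: lez_abs.
have [yc y0 y1] := yP (nu J).
have gz : modulus (g (x - y (nu J))) <= e.
  apply: le_trans (ltW (kP _ kJ)); apply: g_le.
    rewrite mulrCA mulfV ?gt_eqF// mulr1.
    apply: le_trans (eseminormB _ _ (sN false)) _; apply: le_trans (leeD (lexx _) y0) _.
    by rewrite x0E -EFinD lee_fin; have := kap_x0 (nu J); lra.
  apply: le_trans y1 _; rewrite lee_fin ler_pdivlMr//.
  by have := kap_x0 (nu J); have := x0_ge0; lra.
have -> : x = y (nu J) + (x - y (nu J)) by rewrite subrKC.
rewrite gD//; last exact: cap_B.
apply: (@le_trans _ _ (M * (D * \sum_(0 <= j < J.+1) B (nu j) * kap (nu j)) + e)%:E).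
  by rewrite lee_fin; apply: le_trans (modulusD _ _) _; apply: lerD.
rewrite subrKC EFinD leeD2r// mulrA EFinM [leRHS](_ : _ = (M * D)%:E * ((2 * C)%:E * weighted_K x))%E; last first.
  by rewrite muleA -EFinM mulrA.
apply: lee_wpmul2l; first by rewrite lee_fin mulr_ge0// ltW.
rewrite wE; apply: halving_chain_weight => // j.
  by rewrite nuS; have [h _ _] := nxP (nu j); exact: ler_addz1W.
by rewrite nuS; have [_ h _] := nxP (nu j).
Qed.

End dual_estimate.

(** * The seminorm p on the J-space *)

Section weighted_K.
Context {R : realType} {F : scalars} {V : lmodType (scalar_field R F)}.
Variable N : bool -> V -> \bar R.
Hypothesis sN : forall k, eseminorm (N k).
Variables (B a : int -> R) (C : R).
Hypothesis wb : weight_bounds B a C.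
Local Open Scope ereal_scope.

Let d0 (n : int) : (0 < 2 ^ n :> R)%R. Proof. by rewrite exprz_gt0. Qed.

Let K_ge0 (n : int) x : 0 <= K_functional N (2 ^ n)%R x.
Proof. exact: (eseminorm_ge0 (eseminorm_K_functional sN (ltW (d0 n)))). Qed.

Let w0 n : (0 <= 2 ^ (- n) * a n)%R.
Proof. by rewrite mulr_ge0// ltW// (wb_a wb). Qed.

Lemma eseminorm_weighted_K : eseminorm (weighted_K N a).
Proof.
apply: eseminorm_esum => n; apply: eseminorm_scale => //.
by apply: eseminorm_K_functional => //; exact: ltW.
Qed.

(** For n <= k the norm in A_1 gives K(2^n, y) <= 2^(n-k) J(2^k, y) and [wb_upper] sums these terms;
    for n >= k the norm in A_0 gives K(2^n, y) <= J(2^k, y) and [wb_tail] applies. Each half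
    contributes one C. *)
Lemma weighted_K_le_J y (k : int) :
  weighted_K N a y <= (2 * C * (2 ^ (- k) * B k))%:E * J_functional N (2 ^ k)%R y.
Proof.
set J := J_functional _ _ _.
have J0 : 0 <= J by exact: J_functional_ge0.
have f0 n : 0 <= (2 ^ (- n) * a n)%:E * K_functional N (2 ^ n)%R y.
  by rewrite mule_ge0// lee_fin.
rewrite /weighted_K (esumID [set n : int | (n <= k)%R])// !setTI.
have -> : (2 * C * (2 ^ (- k) * B k) = C * (2 ^ (- k) * B k) + C * (2 ^ (- k) * B k))%R by ring.
have CB0 : (0 <= C * (2 ^ (- k) * B k))%R.
  by rewrite !mulr_ge0// ltW ?(wb_C wb) ?(wb_B wb).
rewrite EFinD ge0_muleDl ?lee_fin//; apply: leeD.
- apply: (@le_trans _ _ (\esum_(n in [set n : int | (n <= k)%R]) (((2 ^ (- k))%:E * J) * (a n)%:E))).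
    apply: le_esum => n _.
    have h : K_functional N (2 ^ n)%R y <= (2 ^ n * 2 ^ (- k))%:E * J.
      apply: le_trans (K_functional_le_true sN _ _) _.
      have -> : ((2 ^ n)%:E = (2 ^ n * 2 ^ (- k))%:E * (2 ^ k)%:E :> \bar R).
        by rewrite -EFinM -mulrA -expfzDr// addNr expr0z mulr1.
      rewrite -muleA; apply: lee_wpmul2l; first by rewrite lee_fin mulr_ge0// ltW.
      exact: J_functional_true.
    apply: le_trans (lee_wpmul2l _ h) _; first by rewrite lee_fin.
    rewrite muleAC -EFinM muleA -EFinM.
    have -> // : (2 ^ (- n) * a n * (2 ^ n * 2 ^ (- k)) = 2 ^ (- k) * a n)%R.
    by rewrite -!invr_expz; field; rewrite !gt_eqF.
  apply: le_trans (esumZ_le _ _ _) _.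
  + by rewrite mule_ge0// lee_fin ltW.
  + by move=> n; rewrite lee_fin ltW// (wb_a wb).
  apply: le_trans (lee_wpmul2l _ (wb_upper wb k)) _.
    by rewrite mule_ge0// lee_fin ltW.
  by rewrite muleAC -EFinM mulrCA.
- apply: (@le_trans _ _ (\esum_(n in [set n : int | (k <= n)%R]) (J * (2 ^ (- n) * a n)%:E))).
    apply: le_trans (esum_subset _ (_ : _ `<=` [set n : int | (k <= n)%R])) _.
      by move=> n /= /negP; rewrite -ltNge => /ltW.
    apply: le_esum => n _; rewrite muleC; apply: lee_wpmul2r; first by rewrite lee_fin.
    by apply: le_trans (K_functional_le_false sN _ _) _; exact: J_functional_false.
  apply: le_trans (esumZ_le _ _ _) _ => //.
  by rewrite muleC; apply: lee_wpmul2r => //; exact: (wb_tail wb).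
Qed.

Lemma series_cvg_to_approx (u : int -> V) x (e : R) : (0 < e)%R -> series_cvg_to N u x ->
  exists m n, sum_norm N
    (x - (\sum_(0 <= k < m) u (Posz k) + \sum_(0 <= k < n) u (Negz k)))%R < e%:E.
Proof.
move=> e0; rewrite /series_cvg_to => cu.
have e0' : (0 < e%:E) by rewrite lte_fin.
have H := cu [set y | y < e%:E] (open_ereal_lt' e0').
case: H => -[Q1 Q2] /= [[m _ mQ] [n _ nQ]] sub.
exists m, n; apply: (sub (m, n)); split=> /=; [exact: mQ (leqnn m)|exact: nQ (leqnn n)].
Qed.

(** Finite subadditivity handles a partial sum. The remainder is small in the sum norm, which is
    K(1, .), and K(t, .) <= (1 + t) K(1, .). *)
Lemma K_functional_series (u : int -> V) x (t : R) : (0 < t)%R -> series_cvg_to N u x ->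
  K_functional N t x <= \esum_(k in [set: int]) K_functional N t (u k).
Proof.
move=> t0 cu; have sK := eseminorm_K_functional sN (ltW t0).
have K0 y : 0 <= K_functional N t y by exact: eseminorm_ge0.
apply/lee_addgt0Pr => e e0.
have t1 : (0 < 1 + t)%R by rewrite addr_gt0.
have [m [n mn]] := series_cvg_to_approx (divr_gt0 e0 t1) cu.
set S := (\sum_(0 <= k < m) _ + _)%R in mn.
have -> : x = (S + (x - S))%R by rewrite subrKC.
apply: le_trans (eseminormD sK _ _) _; apply: leeD.
  apply: le_trans (eseminormD sK _ _) _; rewrite esum_split_int//; apply: leeD.
    apply: le_trans (eseminorm_sum _ _ _ sK) _.
    by apply: nneseries_lim_ge.
  apply: le_trans (eseminorm_sum _ _ _ sK) _.
  by apply: nneseries_lim_ge.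
apply: (@le_trans _ _ (K_functional N ((1 + t) * 1) (x - S)%R)).
  by apply: K_functional_mono => //; rewrite mulr1 lerDr.
apply: le_trans (K_functional_quasi sN _ ler01 _) _; first by rewrite lerDl ltW.
by rewrite -sum_normE muleC -lee_pdivlMr// -EFinM ltW.
Qed.

Lemma weighted_K_series (u : int -> V) x : series_cvg_to N u x ->
  weighted_K N a x <= \esum_(k in [set: int]) weighted_K N a (u k).
Proof.
move=> cu; rewrite /weighted_K esum_exchange => [|k n]; last by rewrite mule_ge0// lee_fin.
apply: le_esum => n _; rewrite esumZ//.
apply: lee_wpmul2l; first by rewrite lee_fin.
exact: K_functional_series.
Qed.

(** Countable subadditivity and the bound on each term of a representation give an l^1 sum, which is
    at most the l^q quasi-norm. *)
Lemma weighted_K_le_J_norm (q : R) (b : R -> R) x : (0 < q <= 1)%R ->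
  (forall k : int, B k = b (2 ^ k)) ->
  weighted_K N a x <= (2 * C)%:E * J_norm N q%:E b x.
Proof.
move=> q01 Bb; have C20 : (0 < 2 * C)%R by rewrite mulr_gt0// (wb_C wb).
rewrite muleC -lee_pdivrMr//; apply: le_ereal_inf_tmp => _ [u [capu cu] <-].
rewrite lee_pdivrMr// muleC; apply: le_trans (weighted_K_series cu) _.
set y := fun k : int => _.
have y0 k : 0 <= y k.
  by rewrite /y mule_ge0 ?J_functional_ge0// lee_fin -Bb mulr_ge0 ?(ltW (d0 _)) ?(ltW (wb_B wb _)).
apply: (@le_trans _ _ (\esum_(k in [set: int]) ((2 * C)%:E * y k))).
  apply: le_esum => k _; apply: le_trans (weighted_K_le_J _ k) _.
  by rewrite EFinM -muleA /y Bb.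
rewrite esumZ ?(ltW C20)//; apply: lee_wpmul2l; first by rewrite lee_fin ltW.
apply: le_trans (esum_powR_le q01 y0) _.
by rewrite /ell_norm; under [X in _ <= X `^ _]eq_esum do rewrite gee0_abs//.
Qed.

End weighted_K.

(** * Functionals and the J-space *)

Section functional_bounds.
Context {R : realType} {F : scalars} {V : lmodType (scalar_field R F)}.
Local Notation K := (scalar_field R F).

(** Homogeneity of [N] is replaced by a bound along the line through x, since [N] may be the J-norm,
    for which only such a bound is at hand. As r may be 0, x is scaled by 1/r' for r' > r, and r'
    then tends to r. *)
Lemma functional_bound (N : V -> \bar R) (g : V -> K) (s r : R) (x : V) :
  linear_on N g -> (functional_norm N g <= s%:E)%E -> 0 <= r ->
  (forall c, (N (c *: x) <= (modulus c * r)%:E)%E) -> modulus (g x) <= s * r.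
Proof.
move=> lg gs r0 Nx.
have N0 : (N 0%R < +oo)%E.
  by have := Nx 0; rewrite scale0r modulus0 mul0r => /le_lt_trans; apply; rewrite ltry.
have Nx' : (N x < +oo)%E.
  by have := Nx 1; rewrite scale1r modulus1 mul1r => /le_lt_trans; apply; rewrite ltry.
have g0 : g 0 = 0.
  have := lg 1 0 0 N0 N0; rewrite scaler0 addr0 mul1r.
  by move=> /(congr1 (fun z => z - g 0)); rewrite subrr addrK.
have gE y : (N y <= 1)%E -> modulus (g y) <= s.
  move=> Ny; rewrite -lee_fin; apply: le_trans gs.
  by apply: ereal_sup_ubound; exists y.
have s0 : 0 <= s.
  have := gE 0; rewrite g0 modulus0; apply.
  by have := Nx 0; rewrite scale0r modulus0 mul0r => /le_trans; apply; rewrite lee_fin.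
have H r' : r < r' -> modulus (g x) <= s * r'.
  move=> rr'; have r'0 : 0 < r' by exact: le_lt_trans rr'.
  have [c mc] := @modulus_surj R F r'^-1 (ltac:(by rewrite invr_ge0 ltW)).
  have := gE (c *: x); have := lg c x 0 Nx' N0; rewrite addr0 g0 addr0 => ->.
  rewrite modulusM mc mulrC ler_pdivrMr//; apply.
  apply: le_trans (Nx c) _; rewrite lee_fin mc mulrC ler_pdivrMr// mul1r; exact: ltW.
apply/ler_addgt0Pr => e e0.
have s1 : 0 < s + 1 by rewrite ltr_wpDl.
apply: le_trans (H (r + e / (s + 1)) _) _; first by rewrite ltrDl divr_gt0.
rewrite mulrDr lerD2l mulrCA ger_pMr// ler_pdivrMr// mul1r; lra.
Qed.

Lemma functional_norm_le (N : V -> \bar R) (g : V -> K) (s : R) : 0 <= s ->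
  (forall x, (N x <= 1)%E -> ((modulus (g x))%:E <= s%:E * N x)%E) ->
  (functional_norm N g <= s%:E)%E.
Proof.
move=> s0 gN; apply: ge_ereal_sup => _ [x Nx <-].
apply: le_trans (gN x Nx) _.
by rewrite -[leRHS]mule1; apply: lee_wpmul2l.
Qed.

Lemma continuous_on_bounded (N : V -> \bar R) (g : V -> K) (s : R) : 0 <= s ->
  klinear_on setT g ->
  (forall x, (N x < +oo)%E -> ((modulus (g x))%:E <= s%:E * N x)%E) -> continuous_on N g.
Proof.
move=> s0 lg gN x Nx e e0.
have s1 : 0 < s + 1 by rewrite ltr_wpDl.
exists (e / (s + 1)); first by rewrite divr_gt0.
move=> y Ny Nyx.
have -> : g y - g x = g (y - x).
  by have := lg (-1) x y I I; rewrite scaleN1r mulN1r addrC => ->; rewrite addrC.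
rewrite -lte_fin; apply: le_lt_trans (gN _ _) _.
  by apply: lt_trans Nyx _; rewrite ltry.
apply: (@le_lt_trans _ _ (s%:E * (e / (s + 1))%:E)%E).
  by apply: lee_wpmul2l; rewrite ?lee_fin// ltW.
rewrite -EFinM lte_fin mulrCA gtr_pMr// ltr_pdivrMr// mul1r; lra.
Qed.

(** Extension by 0, so that functionals on the intersection can be evaluated at vectors of [V]; it
    is linear only on [D]. *)
Definition on_set (D : set V) (f : D -> K) (x : V) : K :=
  if pselect (D x) is left Dx then f (SigSub (mem_set Dx)) else 0.

Lemma on_setE (D : set V) (f : D -> K) (x : D) : on_set f (val x) = f x.
Proof.
rewrite /on_set; case: pselect => [Dx|]; first by congr f; exact: val_inj.
by move: (valP x) => /set_mem.
Qed.

End functional_bounds.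

Section J_norm_bound.
Context {R : realType} {F : scalars} {V : lmodType (scalar_field R F)}.
Variable N : bool -> V -> \bar R.
Hypothesis sN : forall k, eseminorm (N k).
Local Open Scope ereal_scope.

(** The representation of x whose only term sits at index k. *)
Lemma J_norm_le_J (q : R) (b : R -> R) x (k : int) : (0 < q)%R ->
  (0 <= b (2 ^ k))%R -> cap_space N x ->
  J_norm N q%:E b x <= (2 ^ (- k) * b (2 ^ k))%:E * J_functional N (2 ^ k) x.
Proof.
move=> q0 b0 Nx.
pose u i := if i == k then x else 0%R.
have capu i : cap_space N (u i).
  by rewrite /u; case: eqP => // _; exact: (submodule_cap sN).1.
have sum0 : sum_norm N 0%R = 0.
  by rewrite sum_normE (eseminorm0 (eseminorm_K_functional sN ler01)).
have cu : series_cvg_to N u x.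
  have E (m n : nat) : is_true (if k is Posz j then (j < m)%N else true) ->
    is_true (if k is Negz j then (j < n)%N else true) ->
    (\sum_(0 <= k < m) u (Posz k) + \sum_(0 <= k < n) u (Negz k) = x)%R.
    rewrite /u; case: (k) => j /= jm jn.
      rewrite [X in (_ + X)%R]big1 // addr0.
      by under eq_bigr do rewrite eqz_nat; rewrite -big_mkcond big_nat1_eq jm.
    rewrite big1 // add0r.
    have NE i : (Negz i == Negz j) = (i == j) by apply/eqP/eqP => [[]|->].
    under eq_bigr do rewrite NE.
    by rewrite -big_mkcond big_nat1_eq jn.
  apply: cvg_near_cst.
  exists ([set m | is_true (if k is Posz j then (j < m)%N else true)],
          [set n | is_true (if k is Negz j then (j < n)%N else true)]) => /=.
    by case: (k) => j /=; split; exists j.+1.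
  by move=> [m n] [/= km kn]; rewrite (E _ _ km kn) subrr.
apply: ereal_inf_le; eexists; first by exists u.
have J0 t : J_functional N t 0%R = 0.
  by rewrite /J_functional !(eseminorm0 (sN _)) mule0 maxxx.
set v := _ * J_functional N (2 ^ k)%R x.
have v0 : 0 <= v.
  by rewrite /v mule_ge0 ?J_functional_ge0// lee_fin mulr_ge0// exprz_ge0.
rewrite /ell_norm.
rewrite (_ : \esum_(i in _) _ = v `^ q).
  by rewrite -poweRrM mulfV ?gt_eqF// poweRe1.
rewrite -(@esum_set1 _ _ k (fun=> v `^ q)) ?poweR_ge0// [RHS]esum_mkcond.
apply: eq_esum => i _; rewrite /u; case: eqVneq => [->|ik].
  by rewrite mem_set// gee0_abs.
by rewrite J0 mule0 abse0 poweR0r ?gt_eqF// memNset// => /= /eqP; apply/negP.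
Qed.

End J_norm_bound.

(** * Functionals represented by series in the dual couple *)

Section dual_couple.
Context {R : realType} {F : scalars} {V : lmodType (scalar_field R F)}.
Local Notation K := (scalar_field R F).
Variable N : bool -> V -> \bar R.
Hypothesis sN : forall k, eseminorm (N k).
Local Notation D := (cap_space N).
Local Notation dualN := (fun k => @dual_norm R F V D (N k)).

Lemma on_setD (f g : D -> K) x : on_set (f + g) x = on_set f x + on_set g x.
Proof. by rewrite /on_set; case: pselect => // _; rewrite addr0. Qed.

Lemma on_setB (f g : D -> K) x : on_set (f - g) x = on_set f x - on_set g x.
Proof. by rewrite /on_set; case: pselect => // _; rewrite subr0. Qed.

Lemma on_set_sum (I : Type) (s : seq I) (f : I -> D -> K) x :
  on_set (\sum_(i <- s) f i) x = \sum_(i <- s) on_set (f i) x.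
Proof.
elim: s => [|i s IH]; last by rewrite !big_cons on_setD IH.
by rewrite !big_nil /on_set; case: pselect.
Qed.

Lemma cap_spaceB x y : D x -> D y -> D (x - y).
Proof. by move=> Nx Ny; rewrite addrC -scaleN1r; apply: (submodule_cap sN).2. Qed.

Lemma dual_norm_ge0 k (f : D -> K) : (0 <= dualN k f)%E.
Proof.
apply: le_ereal_inf_tmp => _ [g _ <-].
apply: (@le_trans _ _ (modulus (g 0))%:E); first by rewrite lee_fin modulus_ge0.
by apply: ereal_sup_ubound; exists 0 => //=; rewrite (eseminorm0 (sN k)).
Qed.

Lemma dual_norm_linear k (f : D -> K) : (dualN k f < +oo)%E -> klinear_on D (on_set f).
Proof.
move=> /ereal_inf_lt[_ [g [lg _ gf] <-] _] c x y Dx Dy.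
have gE z : D z -> on_set f z = g z.
  move=> Dz; rewrite /on_set; case: pselect => // Dz'.
  by rewrite -gf.
rewrite !gE//; first exact: lg.
exact: (submodule_cap sN).2.
Qed.

Lemma dual_norm_bound k (f : D -> K) (r : R) x : (dualN k f <= r%:E)%E -> D x ->
  ((modulus (on_set f x))%:E <= r%:E * N k x)%E.
Proof.
move=> fr Dx; have NkE : N k x = (fine (N k x))%:E.
  by rewrite fineK// ge0_fin_numE ?(eseminorm_ge0 (sN _)).
set nx := fine (N k x) in NkE.
have nx0 : 0 <= nx by rewrite -lee_fin -NkE (eseminorm_ge0 (sN _)).
rewrite NkE -EFinM lee_fin; apply/ler_addgt0Pr => e e0.
have n1 : 0 < nx + 1 by rewrite ltr_wpDl.
have : (dualN k f < (r + e / (nx + 1))%:E)%E.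
  by apply: le_lt_trans fr _; rewrite lte_fin ltrDl divr_gt0.
move=> /ereal_inf_lt[_ [g [lg _ gf] <-] gr].
have -> : on_set f x = g x.
  by rewrite /on_set; case: pselect => // Dx'; rewrite -gf.
apply: le_trans (functional_bound lg (ltW gr) nx0 _) _ => [c|].
  by rewrite EFinM -NkE; exact: (eseminormZ (sN k)).
rewrite mulrDl lerD2l mulrAC ler_pdivrMr// ler_pM2l//; lra.
Qed.

(** Makes convergence in the sum of the dual couple pointwise on [D]. *)
Lemma sum_norm_dual_bound (h : D -> K) (e : R) x : (sum_norm dualN h < e%:E)%E -> D x ->
  modulus (on_set h x) <= e * (fine (N false x) + fine (N true x)).
Proof.
move=> /ereal_inf_lt[_ [[h1 h2] /= -> <-] h12] Dx.
have e1 : (dualN false h1 <= e%:E)%E.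
  by apply: le_trans (ltW h12); rewrite leeDl// dual_norm_ge0.
have e2 : (dualN true h2 <= e%:E)%E.
  by apply: le_trans (ltW h12); rewrite leeDr// dual_norm_ge0.
rewrite on_setD; apply: le_trans (modulusD _ _) _; rewrite mulrDr.
have fin k : N k x = (fine (N k x))%:E.
  by rewrite fineK// ge0_fin_numE ?(eseminorm_ge0 (sN _)).
apply: lerD.
  by have := dual_norm_bound e1 Dx; rewrite fin -EFinM lee_fin.
by have := dual_norm_bound e2 Dx; rewrite fin -EFinM lee_fin.
Qed.

(** If x lies in [D] and x = y + z has finite cost, then y = x - z and z = x - y lie in [D] too, so
    that h, linear only there, splits along the decomposition. *)
Lemma dual_K_bound (h : D -> K) (t c : R) x : 0 < t -> 0 <= c ->
  (dualN false h <= c%:E)%E -> (dualN true h <= (t * c)%:E)%E -> D x ->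
  ((modulus (on_set h x))%:E <= c%:E * K_functional N t x)%E.
Proof.
move=> t0 c0 h1 h2 Dx.
have lh : klinear_on D (on_set h) by apply: (@dual_norm_linear false); apply: le_lt_trans h1 _; rewrite ltry.
have [c_0|cn0] := eqVneq c 0.
  by move: (dual_norm_bound h1 Dx); rewrite c_0 !mul0e.
have cp : 0 < c by rewrite lt_neqAle eq_sym cn0.
rewrite muleC -lee_pdivrMr//; apply: K_functional_ge => y z xE.
have [Ny|] := ltP (N false y) +oo%E; last first.
  rewrite leye_eq => /eqP ->; rewrite addye ?leey// gt_eqF//.
  by rewrite (lt_le_trans ltNy0)// mule_ge0 ?lee_fin 1?(ltW t0)// (eseminorm_ge0 (sN _)).
have [Nz|] := ltP (N true z) +oo%E; last first.
  rewrite leye_eq => /eqP ->; rewrite gt0_muley ?lte_fin// addey ?leey// gt_eqF//.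
  by rewrite (lt_le_trans ltNy0)// (eseminorm_ge0 (sN _)).
have Dy : D y.
  case=> //; have -> : y = x - z by rewrite xE addrK.
  apply: le_lt_trans (eseminormB _ _ (sN true)) _.
  by rewrite lte_add_pinfty// Dx.
have Dz : D z by have -> : z = x - y; [rewrite xE addrC addKr|exact: cap_spaceB].
rewrite lee_pdivrMr// xE.
have -> : on_set h (y + z) = on_set h y + on_set h z.
  by have := lh 1 y z Dy Dz; rewrite scale1r mul1r.
apply: (@le_trans _ _ ((modulus (on_set h y))%:E + (modulus (on_set h z))%:E)%E).
  by rewrite -EFinD lee_fin modulusD.
rewrite muleC ge0_muleDr ?mule_ge0 ?lee_fin ?(ltW t0) ?(eseminorm_ge0 (sN _))//.
apply: leeD; first exact: dual_norm_bound.
by rewrite muleA -EFinM mulrC; exact: dual_norm_bound.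
Qed.

Variables (a : int -> R).
Hypothesis a0 : forall n, 0 < a n.

(** Both conclusions pass to [f] from the partial sums by pointwise convergence; in particular the
    linearity of [f] is derived rather than assumed. *)
Lemma dual_series_bound (f : D -> K) (u : int -> D -> K) (S : R) : 0 <= S ->
  series_cvg_to dualN u f ->
  (forall k, (dualN false (u k) <= (S * (2 ^ k * a (- k)))%:E)%E) ->
  (forall k, (dualN true (u k) <= (S * a (- k))%:E)%E) ->
  klinear_on D (on_set f) /\
  forall x, D x -> ((modulus (on_set f x))%:E <= S%:E * weighted_K N a x)%E.
Proof.
move=> S0 cu u0 u1.
have lu k : klinear_on D (on_set (u k)).
  by apply: (@dual_norm_linear false); apply: le_lt_trans (u0 k) _; rewrite ltry.
pose h m n := \sum_(0 <= k < m) u (Posz k) + \sum_(0 <= k < n) u (Negz k).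
have hE m n x : on_set (h m n) x = \sum_(0 <= k < m) on_set (u (Posz k)) x +
   \sum_(0 <= k < n) on_set (u (Negz k)) x.
  by rewrite /h on_setD !on_set_sum.
have lh m n : klinear_on D (on_set (h m n)).
  move=> c x y Dx Dy; rewrite !hE mulrDr !mulr_sumr addrACA -!big_split /=.
  by congr (_ + _); apply: eq_bigr => k _; exact: lu.
pose n1 x := fine (N false x) + fine (N true x).
have n1_ge0 x : 0 <= n1 x by rewrite addr_ge0// fine_ge0// (eseminorm_ge0 (sN _)).
have approx e : 0 < e -> exists m n, forall x, D x ->
    modulus (on_set f x - on_set (h m n) x) <= e * n1 x.
  move=> e0; have [m [n mn]] := series_cvg_to_approx e0 cu.
  exists m, n => x Dx; rewrite -on_setB; exact: sum_norm_dual_bound.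
split.
- move=> c x y Dx Dy; have Dcxy := (submodule_cap sN).2 c x y Dx Dy.
  apply/eqP; rewrite -subr_eq0; apply/eqP/modulus_eq0/eqP.
  rewrite eq_le modulus_ge0 andbT; apply/ler_addgt0Pr => e e0; rewrite add0r.
  (* The final 1 keeps [T] positive. *)
  pose T := n1 (c *: x + y) + (modulus c * n1 x + n1 y) + 1.
  have T0 : 0 < T.
    have := n1_ge0 (c *: x + y); have := n1_ge0 y.
    by have := mulr_ge0 (modulus_ge0 c) (n1_ge0 x); rewrite /T; lra.
  have [m [n mn]] := approx _ (divr_gt0 e0 T0).
  have -> : on_set f (c *: x + y) - (c * on_set f x + on_set f y) =
      (on_set f (c *: x + y) - on_set (h m n) (c *: x + y)) -
      (c * (on_set f x - on_set (h m n) x) + (on_set f y - on_set (h m n) y)).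
    by rewrite lh//; ring.
  apply: le_trans (modulusD _ _) _; rewrite modulusN.
  apply: (@le_trans _ _ (e / T * n1 (c *: x + y) + (modulus c * (e / T * n1 x) + e / T * n1 y))).
    apply: lerD; first exact: mn.
    apply: le_trans (modulusD _ _) _; apply: lerD; last exact: mn.
    by rewrite modulusM; apply: ler_wpM2l; [exact: modulus_ge0|exact: mn].
  have -> : e / T * n1 (c *: x + y) + (modulus c * (e / T * n1 x) + e / T * n1 y) =
     e / T * (T - 1) by rewrite /T; ring.
  by rewrite mulrBr divfK ?gt_eqF// gerBl mulr1 divr_ge0// ltW.
- move=> x Dx; apply/lee_addgt0Pr => e e0.
  have n2 : 0 < n1 x + 1 by rewrite ltr_wpDl.
  have [m [n mn]] := approx _ (divr_gt0 e0 n2).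
  have -> : on_set f x = on_set (h m n) x + (on_set f x - on_set (h m n) x) by rewrite subrKC.
  apply: (@le_trans _ _ ((modulus (on_set (h m n) x))%:E + e%:E)%E).
    rewrite -EFinD lee_fin; apply: le_trans (modulusD _ _) _; rewrite lerD2l.
    apply: le_trans (mn _ Dx) _; rewrite mulrAC ler_pdivrMr// ler_pM2l//; lra.
  rewrite leeD2r//.
  pose y k := (S%:E * ((2 ^ k * a (- k))%:E * K_functional N (2 ^ (- k)) x))%E.
  have d0 (k : int) : 0 < 2 ^ k :> R by rewrite exprz_gt0.
  have K0 k : (0 <= K_functional N (2 ^ k) x)%E.
    exact: (eseminorm_ge0 (eseminorm_K_functional sN (ltW (d0 k)))).
  have w0 k : 0 <= 2 ^ k * a (- k) by rewrite mulr_ge0// ltW.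
  have y0 k : (0 <= y k)%E by rewrite /y !mule_ge0 ?lee_fin.
  (* Here [dual_K_bound] is taken with t = 2^-k and c = S 2^k a_{-k}: duality reverses the dyadic
     scale. *)
  have uy k : ((modulus (on_set (u k) x))%:E <= y k)%E.
    rewrite /y muleA -EFinM; apply: dual_K_bound => //; first by rewrite mulr_ge0.
    apply: le_trans (u1 k) _; rewrite lee_fin.
    have -> // : 2 ^ (- k) * (S * (2 ^ k * a (- k))) = S * a (- k).
    by rewrite -invr_expz; field; rewrite gt_eqF.
  apply: (@le_trans _ _ (\esum_(k in [set: int]) y k)); last first.
    rewrite esumZ// => [|k]; last by rewrite mule_ge0 ?lee_fin.
    rewrite /weighted_K -[in leRHS]esum_opp.
    by under [in leRHS]eq_esum do rewrite opprK.
  rewrite esum_split_int// hE.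
  apply: (@le_trans _ _ ((\sum_(0 <= k < m) modulus (on_set (u (Posz k)) x)) +
     (\sum_(0 <= k < n) modulus (on_set (u (Negz k)) x)))%:E).
    rewrite lee_fin; apply: le_trans (modulusD _ _) _.
    by apply: lerD; exact: modulus_sum.
  rewrite EFinD -!sumEFin; apply: leeD.
  + apply: le_trans (nneseries_lim_ge m _) => [|k _ _]; last exact: y0.
    by apply: lee_sum => k _.
  + apply: le_trans (nneseries_lim_ge n _) => [|k _ _]; last exact: y0.
    by apply: lee_sum => k _.
Qed.

End dual_couple.

(** * Representation of functionals dominated by p *)

Section dual_series.
Context {R : realType} {F : scalars} {V : lmodType (scalar_field R F)}.
Local Notation K := (scalar_field R F).
Variable N : bool -> V -> \bar R.
Hypothesis sN : forall k, eseminorm (N k).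
Local Notation D := (cap_space N).
Local Notation dualN := (fun k => @dual_norm R F V D (N k)).

Lemma dual_norm_le k (h : V -> K) (s : R) : 0 <= s -> klinear_on setT h ->
  (forall x, ((modulus (h x))%:E <= s%:E * N k x)%E) ->
  (dualN k (fun x : D => h (val x)) <= s%:E)%E.
Proof.
move=> s0 lh hs; apply: ereal_inf_le; exists (functional_norm (N k) h).
  exists h => //; split=> //.
  - by move=> c x y _ _; exact: lh.
  - exact: (continuous_on_bounded s0).
exact: functional_norm_le.
Qed.

Variables (B a : int -> R) (C : R).
Hypothesis wb : weight_bounds B a C.

Let d0 (n : int) : 0 < 2 ^ n :> R. Proof. by rewrite exprz_gt0. Qed.
Let w0 n : 0 <= 2 ^ (- n) * a n. Proof. by rewrite mulr_ge0// ltW// (wb_a wb). Qed.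
Let K0 n x : (0 <= K_functional N (2 ^ n) x)%E.
Proof. exact: (eseminorm_ge0 (eseminorm_K_functional sN (ltW (d0 n)))). Qed.

(** All of [int] gives the diagonal, a singleton one coordinate, and the half-lines [lo] and [hi]
    below give the remainders of the series. *)
Let e (A : pred int) (x : V) : int -> V := fun n => if A n then x else 0.

Let P (X : int -> V) : \bar R :=
  \esum_(n in [set: int]) ((2 ^ (- n) * a n)%:E * K_functional N (2 ^ n) (X n))%E.

Let sP : eseminorm P.
Proof.
apply: eseminorm_esum => n; apply: (eseminorm_scale (w0 n)).
have sK := eseminorm_K_functional sN (ltW (d0 n)).
by split=> [X|X Y|c X]; [exact: K0|exact: (eseminormD sK)|exact: (eseminormZ sK)].
Qed.

Let eP A x : (P (e A x) =
  \esum_(n in [set n | A n]) ((2 ^ (- n) * a n)%:E * K_functional N (2 ^ n) x))%E.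
Proof.
rewrite /P [RHS]esum_mkcond; apply: eq_esum => n _; rewrite /e.
case: ifPn => An; first by rewrite mem_set.
rewrite memNset; last by move=> /=; exact/negP.
by rewrite (eseminorm0 (eseminorm_K_functional sN (ltW (d0 n)))) mule0.
Qed.

Let eL A c x y : e A (c *: x + y) = c *: e A x + e A y.
Proof. by apply/funext => n; rewrite /e !fctE; case: ifP => //; rewrite scaler0 addr0. Qed.

Let eU (A A1 A2 : pred int) x : (forall n, A n = A1 n || A2 n) -> (forall n, ~~ (A1 n && A2 n)) ->
  e A x = e A1 x + e A2 x.
Proof.
move=> AE A12; apply/funext => n; rewrite /e !fctE AE; have := A12 n.
by case: (A1 n); case: (A2 n) => //=; rewrite ?addr0 ?add0r.
Qed.

(* Hahn-Banach on families X : int -> V with the seminorm P, extending the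
   functional g from the constant families; the coordinates of the extension
   decompose g. *)
Lemma dual_series_exists (g : V -> K) (M : R) : 0 <= M -> klinear_on D g ->
  (forall x, D x -> ((modulus (g x))%:E <= M%:E * weighted_K N a x)%E) ->
  exists u : int -> D -> K, [/\
    forall k, (dualN false (u k) <= (M * (2 ^ k * a (- k)))%:E)%E,
    forall k, (dualN true (u k) <= (M * a (- k))%:E)%E &
    series_cvg_to dualN u (fun x : D => g (val x))].
Proof.
move=> M0 lg gM.
pose DD : set (int -> V) := [set X | exists2 x, D x & X = e predT x].
have [D0 Dlin] := submodule_cap sN.
have e0 : e predT 0 = 0 by [].
(* On the diagonal every coordinate equals x; coordinate 0 is the one read off. *)
have [||||G [lG Gg GP]] := @hahn_banach R F (int -> V) (fun X => M%:E * P X)%E DD (fun X => g (X 0)).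
- exact: eseminorm_scale.
- split; first by exists 0.
  move=> c _ _ [x Dx ->] [y Dy ->]; exists (c *: x + y); first exact: Dlin.
  by rewrite eL.
- by move=> c _ _ [x Dx ->] [y Dy ->]; rewrite !fctE /e /= lg.
- move=> _ [x Dx ->]; rewrite /e /=; apply: le_trans (gM _ Dx) _.
  by rewrite /P /weighted_K /=.
pose h A x := G (e A x).
have lh A : klinear_on setT (h A) by move=> c x y _ _; rewrite /h eL lG.
have hM A x : ((modulus (h A x))%:E <= M%:E *
    \esum_(n in [set n | A n]) ((2 ^ (- n) * a n)%:E * K_functional N (2 ^ n) x))%E.
  by rewrite -eP; exact: GP.
have h1 j x : ((modulus (h (pred1 j) x))%:E <= M%:E * ((2 ^ (- j) * a j)%:E * K_functional N (2 ^ j) x))%E.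
  apply: le_trans (hM _ _) _; rewrite (_ : [set n | pred1 j n] = [set j]); last first.
    by apply/seteqP; split=> n /= => [/eqP|->].
  by rewrite esum_set1// mule_ge0 ?lee_fin.
(* The sign is reversed because the norm J(2^k, .) of the dual couple corresponds to K(2^-k, .). *)
exists (fun k x => h (pred1 (- k)) (val x)); split=> [k|k|].
- apply: dual_norm_le => //; first by rewrite mulr_ge0// -{1}[k]opprK.
  move=> x; apply: le_trans (h1 _ _) _; rewrite opprK muleA -EFinM.
  apply: lee_wpmul2l; first by rewrite lee_fin mulr_ge0// -{1}[k]opprK.
  exact: K_functional_le_false.
- apply: dual_norm_le => //; first by rewrite mulr_ge0// ltW// (wb_a wb).
  move=> x; apply: le_trans (h1 _ _) _; rewrite opprK [in leRHS]EFinM -[leRHS]muleA; apply: lee_wpmul2l.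
    by rewrite lee_fin.
  apply: le_trans (lee_wpmul2l _ (K_functional_le_true sN _ _)) _.
    by rewrite lee_fin -{1}[k]opprK.
  rewrite muleA -EFinM.
  have -> // : 2 ^ k * a (- k) * 2 ^ (- k) = a (- k).
  by rewrite -invr_expz; field; rewrite gt_eqF.
have hD A A1 A2 x : (forall n, A n = A1 n || A2 n) -> (forall n, ~~ (A1 n && A2 n)) ->
    h A x = h A1 x + h A2 x.
  move=> AE A12; rewrite /h (eU x AE A12).
  by have := lG 1 (e A1 x) (e A2 x) I I; rewrite scale1r mul1r.
(* The first m terms of index k >= 0 use the coordinates 0, ..., 1 - m, and the first n of negative
   index use 1, ..., n. What remains is the coordinates at most -m and those greater than n. *)
pose lo (m : nat) : pred int := fun n => n <= - m%:Z.
pose hi (n : nat) : pred int := fun j => n%:Z < j.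
have sum_lo m x : \sum_(0 <= k < m) h (pred1 (- k%:Z)) x = h (lo 0%N) x - h (lo m) x.
  elim: m => [|m IH]; first by rewrite big_nil subrr.
  rewrite big_nat_recr//= IH (hD (lo m) (lo m.+1) (pred1 (- m%:Z))).
  - by rewrite opprD addrA subrK.
  - by move=> n; rewrite /lo /=; lia.
  - by move=> n; rewrite /lo /=; lia.
have sum_hi m x : \sum_(0 <= k < m) h (pred1 (- Negz k)) x = h (hi 0%N) x - h (hi m) x.
  elim: m => [|m IH]; first by rewrite big_nil subrr.
  rewrite big_nat_recr//= IH (hD (hi m) (hi m.+1) (pred1 (- Negz m))).
  - by rewrite opprD addrA subrK.
  - by move=> n; rewrite /hi /=; lia.
  - by move=> n; rewrite /hi /=; lia.
have rem m n : (fun x : D => g (val x)) - (\sum_(0 <= k < m) (fun x : D => h (pred1 (- Posz k)) (val x))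
    + \sum_(0 <= k < n) (fun x : D => h (pred1 (- Negz k)) (val x))) =
    (fun x : D => h (hi n) (val x)) + (fun x : D => h (lo m) (val x)).
  apply/funext => x; rewrite !fctE !fct_sumE sum_lo sum_hi.
  have -> : g (val x) = h predT (val x).
    by rewrite /h Gg//; exists (val x) => //; exact/set_mem/valP.
  rewrite (hD predT (lo 0%N) (hi 0%N)).
  - by ring.
  - by move=> j; rewrite /lo /hi /=; lia.
  - by move=> j; rewrite /lo /hi /=; lia.
have C0 := wb_C wb.
have lo_ge0 m : 0 <= M * (C * B (- m%:Z)).
  by rewrite !mulr_ge0 ?(ltW C0) ?(ltW (wb_B wb _)).
(* The extension need not be additive over infinitely many coordinates a priori; its domination by
   [P] makes the low remainder small in the dual of A_1 through [wb_upper], and likewise the high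
   one in the dual of A_0 through [wb_tail]. *)
have lo_le m : (dualN true (fun x : D => h (lo m) (val x)) <= (M * (C * B (- m%:Z)))%:E)%E.
  apply: dual_norm_le => // x; apply: le_trans (hM _ _) _.
  rewrite [in leRHS]EFinM -[leRHS]muleA; apply: lee_wpmul2l; first by rewrite lee_fin.
  have N0 : (0 <= N true x)%E by exact: eseminorm_ge0.
  apply: (@le_trans _ _ (\esum_(n in [set n : int | (n <= - m%:Z)%R]) (N true x * (a n)%:E))%E).
    apply: le_esum => n _.
    apply: le_trans (lee_wpmul2l _ (K_functional_le_true sN _ _)) _; first by rewrite lee_fin.
    rewrite muleA -EFinM muleC.
    have -> // : 2 ^ (- n) * a n * 2 ^ n = a n.
    by rewrite -invr_expz; field; rewrite gt_eqF.
  apply: le_trans (esumZ_le _ _ _) _ => //.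
    by move=> n; rewrite lee_fin ltW// (wb_a wb).
  by rewrite muleC; apply: lee_wpmul2r => //; exact: (wb_upper wb).
have hi_ge0 (n : nat) : 0 <= M * (C * (2 ^ (- (n%:Z + 1)) * B (n%:Z + 1))).
  by rewrite !mulr_ge0 ?(ltW C0) ?(ltW (wb_B wb _)).
have hi_le (n : nat) : (dualN false (fun x : D => h (hi n) (val x)) <=
   (M * (C * (2 ^ (- (n%:Z + 1)) * B (n%:Z + 1))))%:E)%E.
  apply: dual_norm_le => // x; apply: le_trans (hM _ _) _.
  rewrite [in leRHS]EFinM -[leRHS]muleA; apply: lee_wpmul2l; first by rewrite lee_fin.
  have N0 : (0 <= N false x)%E by exact: eseminorm_ge0.
  rewrite (_ : [set j | hi n j] = [set j : int | (n%:Z + 1 <= j)%R]); last first.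
    by apply/seteqP; split=> j; rewrite /hi /=; lia.
  apply: (@le_trans _ _ (\esum_(j in [set j : int | (n%:Z + 1 <= j)%R]) (N false x * (2 ^ (- j) * a j)%:E))%E).
    apply: le_esum => j _; rewrite muleC; apply: lee_wpmul2r; first by rewrite lee_fin.
    exact: K_functional_le_false.
  apply: le_trans (esumZ_le _ _ _) _ => //.
  by rewrite muleC; apply: lee_wpmul2r => //; exact: (wb_tail wb).
rewrite /series_cvg_to.
pose al (m : nat) := M * (C * B (- m%:Z)).
pose be (n : nat) := M * (C * (2 ^ (- (n%:Z + 1)) * B (n%:Z + 1))).
have al0 : (al m @[m --> \oo] --> 0)%classic.
  apply/cvgrPdist_lt => r r0.
  have MC : 0 < M * C + 1 by rewrite ltr_wpDl// mulr_ge0// ltW.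
  have [k kP] := wb_cvgN wb (divr_gt0 r0 MC).
  exists `|k|%N => // m /= km; rewrite sub0r normrN ger0_norm; last exact: lo_ge0.
  have : B (- m%:Z) < r / (M * C + 1) by apply: kP; lia.
  rewrite ltr_pdivlMr// mulrC mulrDl mul1r /al mulrA => H.
  by have := wb_B wb (- m%:Z); lra.
have be0 : (be m @[m --> \oo] --> 0)%classic.
  apply/cvgrPdist_lt => r r0.
  have MC : 0 < M * C + 1 by rewrite ltr_wpDl// mulr_ge0// ltW.
  have [k kP] := wb_cvg0 wb (divr_gt0 r0 MC).
  exists `|k|%N => // m /= km; rewrite sub0r normrN ger0_norm; last exact: hi_ge0.
  have : 2 ^ (- (m%:Z + 1)) * B (m%:Z + 1) < r / (M * C + 1) by apply: kP; lia.
  rewrite ltr_pdivlMr// mulrC mulrDl mul1r /be mulrA => H.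
  by have := mulr_gt0 (d0 (- (m%:Z + 1))) (wb_B wb (m%:Z + 1)); lra.
apply: (@squeeze_cvge _ _ _ _ (fun=> 0%E) _ (fun mn => (al mn.1 + be mn.2)%:E)).
- apply: nearW => -[m n] /=; apply/andP; split.
    apply: le_ereal_inf_tmp => _ [[y z] _ <-] /=.
    by rewrite adde_ge0// dual_norm_ge0.
  rewrite rem; apply: ereal_inf_le; eexists.
    by exists (fun x : D => h (hi n) (val x), fun x : D => h (lo m) (val x)).
  by rewrite /= [(al _ + _)%R]addrC EFinD; apply: leeD; [exact: hi_le|exact: lo_le].
- exact: cvg_cst.
- apply: cvg_EFin; first by apply: nearW.
  rewrite -[X in _ --> X]addr0; apply: cvgD.
  + exact: (cvg_comp fst al cvg_fst al0).
  + exact: (cvg_comp snd be cvg_snd be0).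
Qed.

End dual_series.

(** * The duality theorem *)

Section couple.
Context {R : realType} {F : scalars}.
Local Notation K := (scalar_field R F).
Variable A : banach_couple K.

Lemma couple_normE k (x : side A k) :
  couple_norm (F := F) k (emb A k x) = (real_part `|x|)%:E.
Proof.
apply/eqP; rewrite eq_le; apply/andP; split.
  by apply: ereal_inf_lbound; exists x.
by apply: le_ereal_inf_tmp => _ [y /= /emb_inj -> <-].
Qed.

Lemma couple_norm_oo k (x : ambient A) :
  ~ range (emb A k) x -> couple_norm (F := F) k x = +oo%E.
Proof.
move=> nx; apply/eqP; rewrite eq_le leey /=.
by apply: le_ereal_inf_tmp => _ [y /= yx <-]; exfalso; apply: nx; exists y.
Qed.

Lemma eseminorm_couple_norm k : eseminorm (couple_norm (F := F) (A := A) k).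
Proof.
have ge0 x : (0 <= couple_norm (F := F) (A := A) k x)%E.
  by apply: le_ereal_inf_tmp => _ [y _ <-]; rewrite lee_fin real_part_ge0.
split=> [//|x y|c x].
- have [[x' _ <-]|nx] := pselect (range (emb A k) x); last first.
    by rewrite (couple_norm_oo nx) addye ?leey// gt_eqF// (lt_le_trans ltNy0).
  have [[y' _ <-]|ny] := pselect (range (emb A k) y); last first.
    by rewrite (couple_norm_oo ny) addey ?leey// gt_eqF// (lt_le_trans ltNy0).
  rewrite -raddfD !couple_normE -EFinD lee_fin -real_partD.
  exact/real_part_le/ler_normD.
- have [->|c0] := eqVneq c 0.
    rewrite scale0r modulus0 mul0e -(raddf0 (emb A k)) couple_normE normr0.
    by rewrite real_part0.
  have mc : 0 < modulus c.
    by rewrite lt_neqAle modulus_ge0 andbT eq_sym; apply: contra c0 => /eqP /modulus_eq0 ->.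
  have [[x' _ <-]|nx] := pselect (range (emb A k) x); last first.
    by rewrite (couple_norm_oo nx) gt0_muley ?lte_fin// leey.
  by rewrite -linearZ /= !couple_normE -EFinM lee_fin normrZ real_partM.
Qed.

End couple.

Section duality.
Context {R : realType} {F : scalars} {V : lmodType (scalar_field R F)}.
Local Notation K := (scalar_field R F).
Variable N : bool -> V -> \bar R.
Hypothesis sN : forall k, eseminorm (N k).
Local Notation D := (cap_space N).
Local Notation dualN := (fun k => @dual_norm R F V D (N k)).
Variables (B a : R -> R) (C : R).
Hypothesis wb : weight_bounds (fun k : int => B (2 ^ k)) (fun k : int => a (2 ^ k)) C.
Variable q : R.
Hypothesis q01 : 0 < q <= 1.

Let d0 (n : int) : 0 < 2 ^ n :> R. Proof. by rewrite exprz_gt0. Qed.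
Let B0 k := wb_B wb k.
Let a0 k := wb_a wb k.

(** A representation of size S gives |f| <= S p on the intersection. Hahn-Banach extends f to the
    whole space below S p, and p <= 2 C times the J-norm makes the extension continuous on the
    J-space. *)
Lemma dual_norm_le_J_norm (f : D -> K) :
  (dual_norm (D := D) (J_norm N q%:E B) f <=
   (2 * C)%:E * J_norm dualN +oo%E (fun t => (a t^-1)^-1)%R f)%E.
Proof.
have C0 : 0 < 2 * C by rewrite mulr_gt0// (wb_C wb).
rewrite muleC -lee_pdivrMr//; apply: le_ereal_inf_tmp => _ [u [_ cu] <-].
rewrite lee_pdivrMr//.
set T := ell_norm _ _.
have uT k : ((2 ^ (- k) * (a (2 ^ (- k)))^-1)%:E * J_functional dualN (2 ^ k) (u k) <= T)%E.
  apply: le_trans (lee_abs _) _.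
  by apply: ereal_sup_ubound; exists k => //; rewrite invr_expz.
have T0 : (0 <= T)%E.
  apply: le_trans (uT 0); rewrite mule_ge0 ?lee_fin//.
    by rewrite mulr_ge0 ?invr_ge0 ?(ltW (d0 _)) ?(ltW (a0 _)).
  by rewrite /J_functional le_max dual_norm_ge0.
have [S TS] : exists S, T = S%:E \/ T = +oo%E.
  by move: T0; case: (T) => [S _| |//]; [exists S; left|exists 0; right].
case: TS => TS; last by rewrite TS gt0_mulye ?lte_fin// leey.
have S0 : 0 <= S by rewrite -lee_fin -TS.
have uS k : (J_functional dualN (2 ^ k) (u k) <= (S * (2 ^ k * a (2 ^ (- k))))%:E)%E.
  have := uT k; rewrite TS muleC -lee_pdivlMr ?mulr_gt0 ?invr_gt0 ?a0//.
  move=> /le_trans; apply; rewrite -EFinM lee_fin.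
  have ak := a0 (- k); rewrite -(invr_expz 2 k) invfM !invrK.
  by rewrite mulrCA.
have u0 k : (dualN false (u k) <= (S * (2 ^ k * a (2 ^ (- k))))%:E)%E.
  by apply: le_trans (uS k); exact: J_functional_false.
have u1 k : (dualN true (u k) <= (S * a (2 ^ (- k)))%:E)%E.
  have := le_trans (J_functional_true _ _ _) (uS k).
  by rewrite mulrCA EFinM lee_pmul2l ?lte_fin.
have [lf fS] := dual_series_bound sN a0 S0 cu u0 u1.
have sw := eseminorm_scale S0 (eseminorm_weighted_K sN wb).
have [g [lg gf gS]] := hahn_banach sw (submodule_cap sN) lf fS.
have gJ x : ((modulus (g x))%:E <= (S * (2 * C))%:E * J_norm N q%:E B x)%E.
  apply: le_trans (gS x I) _; rewrite EFinM -muleA; apply: lee_wpmul2l; first by rewrite lee_fin.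
  exact: (weighted_K_le_J_norm sN wb).
have SC0 : 0 <= S * (2 * C) by rewrite mulr_ge0// ltW.
apply: ereal_inf_le; exists (functional_norm (J_norm N q%:E B) g); last first.
  by rewrite TS -EFinM; apply: functional_norm_le.
exists g => //; split.
- by move=> c x y _ _; exact: lg.
- exact: (continuous_on_bounded SC0).
- by move=> x; rewrite gf ?on_setE//; exact/set_mem/valP.
Qed.

Variable Cg : R.
Hypothesis Cg0 : 0 < Cg.
Hypothesis closed_true : forall x, (N true x <= Cg%:E * gagliardo_norm N true x)%E.

(** One-term representations turn the norm M of an extension g into the family of bounds required by
    [dual_estimate]. The resulting domination by p yields the series, in which the weights cancel
    and leave M times the constant. *)
Lemma J_norm_le_dual_norm (f : D -> K) :
  (J_norm dualN +oo%E (fun t => (a t^-1)^-1)%R f <=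
   ((4 * Cg + 16) * (2 * C))%:E * dual_norm (D := D) (J_norm N q%:E B) f)%E.
Proof.
have /andP[q0 _] := q01.
set C2 := (4 * Cg + 16) * (2 * C).
have C20 : 0 < C2 by rewrite !mulr_gt0 ?(wb_C wb)// addr_gt0// mulr_gt0.
rewrite muleC -lee_pdivrMr//; apply: le_ereal_inf_tmp => _ [g [lg _ gf] <-].
rewrite lee_pdivrMr//.
set T := functional_norm _ _.
have JJ x k : D x -> (J_norm N q%:E B x <= (2 ^ (- k) * B (2 ^ k))%:E * J_functional N (2 ^ k) x)%E.
  by move=> Dx; apply: J_norm_le_J => //; rewrite ltW// B0.
have Jfin x k : D x -> (J_functional N (2 ^ k) x < +oo)%E.
  by move=> Dx; rewrite /J_functional gt_max Dx lte_mul_pinfty ?lee_fin ?(ltW (d0 k)) ?Dx.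
have Bk0 k : 0 <= 2 ^ (- k) * B (2 ^ k) by rewrite mulr_ge0 ?(ltW (d0 _)) ?(ltW (B0 _)).
have D0 : D 0 := (submodule_cap sN).1.
have J0 : (J_norm N q%:E B 0%R <= 0)%E.
  apply: le_trans (JJ 0 0 D0) _.
  by rewrite /J_functional !(eseminorm0 (sN _)) mule0 maxxx mule0.
have T0 : (0 <= T)%E.
  apply: (@le_trans _ _ (modulus (g 0))%:E); first by rewrite lee_fin modulus_ge0.
  by apply: ereal_sup_ubound; exists 0 => //=; apply: le_trans J0 _.
have [M TM] : exists M, T = M%:E \/ T = +oo%E.
  by move: T0; case: (T) => [S _| |//]; [exists S; left|exists 0; right].
case: TM => TM; last by rewrite TM gt0_mulye ?lte_fin// leey.
have M0 : 0 <= M by rewrite -lee_fin -TM.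
have lgD : klinear_on D g.
  by move=> c x y Dx Dy; apply: lg; [apply: le_lt_trans (JJ x 0 Dx) _|apply: le_lt_trans (JJ y 0 Dy) _];
    rewrite lte_mul_pinfty ?lee_fin// Jfin.
have gJ x : D x -> forall k : int, ((modulus (g x))%:E <=
    (M * (2 ^ (- k) * B (2 ^ k)))%:E * J_functional N (2 ^ k) x)%E.
  move=> Dx k.
  have JE : J_functional N (2 ^ k) x = (fine (J_functional N (2 ^ k) x))%:E.
    by rewrite fineK// ge0_fin_numE ?Jfin ?(J_functional_ge0 sN).
  set j := fine _ in JE.
  have j0 : 0 <= j by rewrite -lee_fin -JE (J_functional_ge0 sN).
  rewrite JE -EFinM lee_fin -mulrA.
  apply: (functional_bound lg) => [||c]; [by rewrite -/T TM|by rewrite mulr_ge0|].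
  apply: le_trans (JJ _ k _) _.
    by rewrite -[_ *: _]addr0; exact: (submodule_cap sN).2.
  rewrite [in leRHS]mulrCA [in leRHS]EFinM; apply: lee_wpmul2l; first by rewrite lee_fin.
  rewrite EFinM -JE /J_functional ge_max; apply/andP; split.
    apply: le_trans (eseminormZ (sN _) _ _) _; apply: lee_wpmul2l.
      by rewrite lee_fin modulus_ge0.
    by rewrite le_max lexx.
  apply: le_trans (lee_wpmul2l _ (eseminormZ (sN _) _ _)) _; first by rewrite lee_fin ltW.
  rewrite muleCA; apply: lee_wpmul2l; first by rewrite lee_fin modulus_ge0.
  by rewrite le_max lexx orbT.
have gw := dual_estimate sN wb Cg0 closed_true M0 lgD gJ.
have MC0 : 0 <= M * C2 by rewrite mulr_ge0// ltW.
have [u [u0 u1 cu]] := dual_series_exists sN wb MC0 lgD gw.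
have fE : f = (fun x : D => g (val x)) by apply/funext => x; rewrite gf.
rewrite fE; apply: ereal_inf_le; eexists.
  exists u => //; split=> // k [].
    by apply: le_lt_trans (u1 k) _; rewrite ltry.
  by apply: le_lt_trans (u0 k) _; rewrite ltry.
apply: ge_ereal_sup => _ [k _ <-].
have ak := a0 (- k).
have kE : ((2 : R) ^ k)^-1 = 2 ^ (- k) by rewrite invr_expz.
have J1 : (J_functional dualN (2 ^ k) (u k) <= (M * C2 * (2 ^ k * a (2 ^ (- k))))%:E)%E.
  rewrite /J_functional ge_max u0 /=; have k0 : (0 <= (2 ^ k)%:E :> \bar R)%E by rewrite lee_fin ltW.
  apply: le_trans (lee_wpmul2l k0 (u1 k)) _.
  by rewrite -EFinM lee_fin mulrCA.
have c0 : 0 <= 2 ^ (- k) * (a (2 ^ (- k)))^-1.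
  by rewrite mulr_ge0 ?invr_ge0 ?(ltW (d0 _)) ?(ltW ak).
have Jge0 : (0 <= J_functional dualN (2 ^ k) (u k))%E.
  by rewrite /J_functional le_max dual_norm_ge0.
rewrite kE gee0_abs; last by rewrite mule_ge0 ?lee_fin.
apply: le_trans (lee_wpmul2l _ J1) _; first by rewrite lee_fin.
rewrite TM -!EFinM lee_fin.
have -> // : 2 ^ (- k) / a (2 ^ (- k)) * (M * C2 * (2 ^ k * a (2 ^ (- k)))) = M * C2.
by rewrite -invr_expz; field; rewrite invr_expz !gt_eqF.
Qed.

End duality.

Theorem theorem4p5 (R : realType) (F : scalars)
    (A : banach_couple (scalar_field R F)) (q : R) (B b : R -> R) :
  mutually_closed (@couple_norm R F A) ->
  regular_couple A ->
  0 < q <= 1 ->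
  slowly_varying B ->
  (ereal_sup (range (fun m : int =>
     (Num.min 1 (2 ^ m) / B (2 ^ m))%:E)) < +oo)%E ->
  slowly_varying b ->
  (forall t, 0 < t ->
     ((B t `^ q)%:E =
      \int[completed_lebesgue_measure]_(s in `]0%R, t[) (b s `^ q / s)%:E)%E) ->
  let a := fun t : R => q^-1 * B t `^ (1 - q) * b t `^ q in
  {ae completed_lebesgue_measure,
     forall t : R, 0 < t -> derivable B t 1 /\ t * derive1 B t = a t} /\
  norm_equiv
    (dual_norm (D := @couple_cap R F A)
       (J_norm (@couple_norm R F A) q%:E B))
    (J_norm (@dual_couple_norm R F A) +oo%E (fun t => (a t^-1)^-1)).
Proof.
move=> closedA _ q01 svB _ svb BE a.
have /andP[q0 _] := q01; have [_ B0 _] := svB; have [mb _ _] := svb.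
split; first exact: (ae_derive_primitive q0 mb B0 BE).
have [C wb] := dyadic_weight_bounds q01 svB svb BE.
have [Cg Cg0 CgP] := closedA true.
have sN k := eseminorm_couple_norm (F := F) A k.
have C0 := wb_C wb.
have C20 : 0 < (4 * Cg + 16) * (2 * C) by rewrite !mulr_gt0// addr_gt0// mulr_gt0.
have J0 f : (0 <= J_norm (@dual_couple_norm R F A) +oo%E (fun t => (a t^-1)^-1)%R f)%E.
  apply: le_ereal_inf_tmp => _ [u _ <-].
  by apply: le_trans (abse_ge0 _) (ereal_sup_ubound _); exists 0.
have {}wb : weight_bounds (fun k : int => B (2 ^ k)) (fun k : int => a (2 ^ k)) C := wb.
have le1 f := dual_norm_le_J_norm (a := a) sN wb q01 f.
have le2 f := J_norm_le_dual_norm (a := a) sN wb q01 Cg0 (fun x => (CgP x).1) f.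
exists (2 * C + (4 * Cg + 16) * (2 * C)) => [|f]; first by rewrite addr_gt0// mulr_gt0.
split.
- apply: le_trans (le1 f) _; apply: lee_wpmul2r; first exact: J0.
  by rewrite lee_fin lerDl ltW.
- apply: le_trans (le2 f) _; apply: lee_wpmul2r; last first.
    by rewrite lee_fin lerDr mulr_ge0// ltW.
  (* Nonnegativity of the dual norm is read off from [le2], whose left-hand side is nonnegative. *)
  by have := le_trans (J0 f) (le2 f); rewrite pmule_rge0 ?lte_fin.
Qed.
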